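(* Let $\mathfrak{g}$ be a complex simple finite-dimensional Lie algebra not isomorphic to $\mathfrak{sl}(2,\mathbb{C})$, let $\mathfrak{Z}(\mathfrak{g})$ be the center of $U(\mathfrak{g})$, and let $\lambda\in\mathfrak{h}^*$. Then $$zv=\chi_{\lambda+\rho}(z)v$$ for all $z\in\mathfrak{Z}(\mathfrak{g})$ and $v\in W^{\mathfrak{g}}_{\mathfrak{b}}(\lambda)$.
   Context: $\mathfrak{h}$ is a Cartan subalgebra of $\mathfrak{g}$, $\Delta^+$ a positive root system, $\mathfrak{n}=\bigoplus_{\alpha\in\Delta^+}\mathfrak{g}_\alpha$, $\overline{\mathfrak{n}}=\bigoplus_{\alpha\in\Delta^+}\mathfrak{g}_{-\alpha}$, $\mathfrak{b}=\mathfrak{h}\oplus\mathfrak{n}$, $\rho=\frac12\sum_{\alpha\in\Delta^+}\alpha$, $\theta$ the maximal root, $\Delta^+_\theta=\Delta^+\setminus\{\theta\}$. $\{f_\alpha;\,\alpha\in\Delta^+\}$ is a root basis of $\overline{\mathfrak{n}}$ ($f_\alpha\in\mathfrak{g}_{-\alpha}$) with corresponding linear coordinate functions $x_\alpha$ on $\overline{\mathfrak{n}}$, and $u(x)=\sum_{\alpha\in\Delta^+}x_\alpha f_\alpha$. The Weyl algebra $\mathcal{A}$ of $\overline{\mathfrak{n}}$ is generated by $x_\alpha,\partial_{x_\alpha}$ ($\alpha\in\Delta^+$) with the canonical commutation relations. For $\mu\in\mathfrak{h}^*$ there is a Lie algebra homomorphism $\pi_\mu\colon\mathfrak{g}\to\mathcal{A}$,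 $$\pi_\mu(a)=-\sum_{\alpha\in\Delta^+}\bigg[\frac{\operatorname{ad}(u(x))e^{\operatorname{ad}(u(x))}}{e^{\operatorname{ad}(u(x))}-\mathrm{id}}\,(e^{-\operatorname{ad}(u(x))}a)_{\overline{\mathfrak{n}}}\bigg]_\alpha\partial_{x_\alpha}+(\mu+\rho)\big((e^{-\operatorname{ad}(u(x))}a)_{\mathfrak{h}}\big),$$ where $\operatorname{ad}(u(x))$ acts on $\mathbb{C}[\overline{\mathfrak{n}}]\otimes\mathfrak{g}$ (the fraction is the power series $te^t/(e^t-1)$ at the nilpotent operator $t=\operatorname{ad}(u(x))$), $[\cdot]_\alpha$ is the coordinate with respect to $f_\alpha$, and $a_{\overline{\mathfrak{n}}},a_{\mathfrak{h}}$ are the components in $\mathfrak{g}=\overline{\mathfrak{n}}\oplus\mathfrak{h}\oplus\mathfrak{n}$ (all extended $\mathbb{C}[\overline{\mathfrak{n}}]$-linearly). $W^{\mathfrak{g}}_{\mathfrak{b}}(\lambda)=\mathcal{A}/\mathcal{I}_{\rm GT}\simeq\mathbb{C}[\partial_{x_\alpha},\alpha\in\Delta^+_\theta,\,x_\theta]$, where $\mathcal{I}_{\rm GT}$ is the left ideal generated by $x_\alpha$ ($\alpha\in\Delta^+_\theta$) and $\partial_{x_\theta}$, with $\mathfrak{g}$-module structure given through $\pi_{\lambda+\rho}$. Central characters: let $p\colon U(\mathfrak{g})\to U(\mathfrak{h})$ be the projection with respect to $U(\mathfrak{g})=U(\mathfrak{h})\oplus(\overline{\mathfrak{n}}\,U(\mathfrak{g})+U(\mathfrak{g})\,\mathfrak{n})$,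 and let $f\colon U(\mathfrak{h})\to U(\mathfrak{h})$ be the algebra automorphism with $f(h)=h-\rho(h)1$ for $h\in\mathfrak{h}$. The Harish-Chandra homomorphism $\gamma\colon\mathfrak{Z}(\mathfrak{g})\to U(\mathfrak{h})$ is the restriction of $f\circ p$ to $\mathfrak{Z}(\mathfrak{g})$. For $\mu\in\mathfrak{h}^*$, $\chi_\mu(z)=(\gamma(z))(\mu)$, where $U(\mathfrak{h})\simeq S(\mathfrak{h})$ is identified with polynomial functions on $\mathfrak{h}^*$. *)

(* Defs.v *)
From HB Require Import structures.
From mathcomp Require Import all_boot all_order all_algebra.
From mathcomp Require Import finmap.
From mathcomp Require Import boolp classical_sets reals complex.
(* The notations of monalg clash with those of mpoly. *)
From mathcomp Require Import -(notations) monalg.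
From mathcomp Require Import mpoly.

Set Implicit Arguments.
Unset Strict Implicit.
Unset Printing Implicit Defensive.

Import GRing.Theory.

Local Open Scope ring_scope.
Local Open Scope quotient_scope.

HB.mixin Record isLieAlgebra (F : fieldType) V of Vector F V := {
  lie : V -> V -> V;
  lie_linearl : forall y, linear (lie^~ y);
  lie_linearr : forall x, linear (lie x);
  lie_alt : forall x, lie x x = 0;
  lie_jacobi : forall x y z,
    lie x (lie y z) + lie y (lie z x) + lie z (lie x y) = 0
}.

#[short(type="lieAlgType")]
HB.structure Definition LieAlgebra (F : fieldType) :=
  {V of isLieAlgebra F V & Vector F V}.

Section LieAlgebraTheory.
Variables (F : fieldType) (g : lieAlgType F).

HB.instance Definition _ (x : g) :=
  GRing.isLinear.Build F g g *:%R (lie x) (lie_linearr x).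

Definition lier (y x : g) := lie x y.

HB.instance Definition _ (y : g) :=
  GRing.isLinear.Build F g g *:%R (lier y) (lie_linearl y).

Definition ad (x : g) : 'End(g) := linfun (lie x).

Lemma adE x y : ad x y = lie x y.
Proof. exact: lfunE. Qed.

Definition simple_lie : Prop :=
  (exists x y : g, lie x y != 0) /\
  forall I : {vspace g},
    (forall x y, y \in I -> lie x y \in I) -> I = 0%VS \/ I = fullv.

(* [phi] is an isomorphism of g onto the trace-zero matrices with the
   commutator bracket. *)
Definition isomorphic_to_sl2 : Prop :=
  exists phi : g -> 'M[F]_2,
    [/\ linear phi, injective phi,
        forall M, \tr M = 0 <-> exists x, phi x = M
      & forall x y, phi (lie x y) = phi x *m phi y - phi y *m phi x].

Definition ad_diagonalizable (x : g) : Prop :=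
  exists2 e : seq g, basis_of fullv e &
    forall v, v \in e -> exists c : F, lie x v = c *: v.

(* Cartan subalgebras of a semisimple Lie algebra: toral subalgebras (abelian,
   consisting of ad-diagonalizable elements) equal to their own centralizer. *)
Definition cartan_subalgebra (h : {vspace g}) : Prop :=
  [/\ forall x y, x \in h -> y \in h -> lie x y = 0,
      forall x, x \in h -> ad_diagonalizable x
    & forall x, (forall t, t \in h -> lie t x = 0) -> x \in h].

Definition dual (h : {vspace g}) := 'Hom(subvs_of h, F^o).

HB.instance Definition _ h := GRing.Lmodule.on (dual h).

Section Roots.
Variable h : {vspace g}.

(* The weight space {x | [t, x] = alpha(t) x for all t in h}; see
   [root_spaceP]. *)
Definition root_space (alpha : dual h) : {vspace g} :=
  (\bigcap_(i < \dim h)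
     lker (ad (vbasis h)`_i -
           (alpha (vsproj h (vbasis h)`_i) : F) *: (\1%VF : 'End(g))))%VS.

Lemma root_spaceP (alpha : dual h) x :
  x \in root_space alpha <->
  forall t : subvs_of h, lie (vsval t) x = (alpha t : F) *: x.
Proof.
have kerE (t : g) (c : F) : (x \in lker (ad t - c *: (\1%VF : 'End(g)))) = (ad t x == c *: x).
  by rewrite memv_ker !lfun_simp subr_eq0.
split=> [xa t | xa]; last first.
  rewrite /root_space memvE; apply/subv_bigcapP => i _; rewrite -memvE kerE adE.
  by rewrite -xa vsprojK // vbasis_mem // mem_nth ?size_tuple.
have xi i : (i < \dim h)%N ->
    lie (vbasis h)`_i x = (alpha (vsproj h (vbasis h)`_i) : F) *: x.
  move=> lti; apply/eqP; rewrite -adE -kerE.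
  move: xa; rewrite /root_space memvE => /subv_bigcapP /(_ (Ordinal lti) isT).
  by rewrite -memvE.
have [c tE] : exists c : 'I_(\dim h) -> F, vsval t = \sum_i c i *: (vbasis h)`_i.
  by exists (fun i => coord (vbasis h) i (vsval t)); apply: coord_vbasis (subvsP t).
have -> : alpha t = \sum_i c i *: alpha (vsproj h (vbasis h)`_i).
  by rewrite -[t in LHS]vsvalK tE !linear_sum; apply: eq_bigr => i _; rewrite !linearZ.
rewrite tE -/(lier x _) linear_sum scaler_suml; apply: eq_bigr => i _.
by rewrite linearZ /= /lier xi // scalerA.
Qed.

Definition is_root (alpha : dual h) : Prop :=
  alpha != 0 /\ root_space alpha <> 0%VS.

Section PositiveRoots.
Variables (N : nat) (alpha : 'I_N -> dual h).

(* [alpha] enumerates without repetition a positive system. *)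
Definition positive_system : Prop :=
  [/\ injective alpha,
      forall i, is_root (alpha i) /\ forall j, alpha j <> - alpha i,
      forall beta, is_root beta -> exists i, beta = alpha i \/ beta = - alpha i
    & forall i j, is_root (alpha i + alpha j) ->
        exists k, alpha k = alpha i + alpha j].

Definition maximal_root (theta : 'I_N) : Prop :=
  forall i, exists c : 'I_N -> nat,
    alpha theta - alpha i = \sum_(j < N) alpha j *+ c j.

Definition half_sum : dual h := 2%:R^-1 *: \sum_(i < N) alpha i.

Definition nplus : {vspace g} := (\sum_(i < N) root_space (alpha i))%VS.
Definition nminus : {vspace g} := (\sum_(i < N) root_space (- alpha i))%VS.

Definition root_basis (f : N.-tuple g) : Prop :=
  basis_of nminus f /\ forall i : 'I_N, tnth f i \in root_space (- alpha i).

(* Components along g = nminus (+) h (+) nplus. *)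
Definition proj_nminus : 'End(g) := daddv_pi nminus (h + nplus)%VS.
Definition proj_h : 'End(g) := daddv_pi h (nminus + nplus)%VS.

End PositiveRoots.
End Roots.
End LieAlgebraTheory.

Inductive left_ideal (A : pzRingType) (S : A -> Prop) : A -> Prop :=
| LI_mul a s : S s -> left_ideal S (a * s)
| LI_zero : left_ideal S 0
| LI_sub a b : left_ideal S a -> left_ideal S b -> left_ideal S (a - b).

Inductive two_sided_ideal (A : pzRingType) (S : A -> Prop) : A -> Prop :=
| TI_mul a s b : S s -> two_sided_ideal S (a * s * b)
| TI_zero : two_sided_ideal S 0
| TI_sub a b :
    two_sided_ideal S a -> two_sided_ideal S b -> two_sided_ideal S (a - b).

Section CyclicModule.
Variables (A : pzRingType) (S : A -> Prop).

Definition left_idealb : {pred A} := fun a => `[< left_ideal S a >].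

Fact left_idealb_zmod_closed : zmod_closed left_idealb.
Proof.
split=> [|a b /asboolP Sa /asboolP Sb]; apply/asboolP; first exact: LI_zero.
exact: LI_sub.
Qed.

HB.instance Definition _ :=
  GRing.isZmodClosed.Build A left_idealb left_idealb_zmod_closed.

Fact left_idealbM a b : b \in left_idealb -> a * b \in left_idealb.
Proof.
move=> /asboolP Sb; apply/asboolP; elim: Sb a => [b' s Ss|| b1 b2 _ IH1 _ IH2] a.
- by rewrite mulrA; apply: LI_mul.
- by rewrite mulr0; apply: LI_zero.
- by rewrite mulrBr; apply: LI_sub.
Qed.

(* The left A-module A / I, I the left ideal generated by S. *)
Definition cyclic_module : Type := Quotient.quot left_idealb.

HB.instance Definition _ := GRing.Zmodule.on cyclic_module.

Definition cyclic_pi (a : A) : cyclic_module := \pi_(Quotient.quot left_idealb) a.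

Lemma cyclic_piE a b :
  cyclic_pi a = cyclic_pi b <-> left_ideal S (a - b).
Proof.
rewrite /cyclic_pi; split=> [/eqP | Sab].
  by rewrite -Quotient.idealrBE => /asboolP.
by apply/eqP; rewrite -Quotient.idealrBE; apply/asboolP.
Qed.

Lemma cyclic_pi_surj v : exists a, v = cyclic_pi a.
Proof. by exists (repr v); rewrite /cyclic_pi reprK. Qed.

Lemma cyclic_piD : {morph cyclic_pi : a b / a + b}.
Proof. by move=> a b; rewrite /cyclic_pi !piE. Qed.

Definition cyclic_scale (a : A) (v : cyclic_module) : cyclic_module :=
  cyclic_pi (a * repr v).

Lemma cyclic_scaleE a b : cyclic_scale a (cyclic_pi b) = cyclic_pi (a * b).
Proof.
apply/cyclic_piE; rewrite -mulrBr; apply/asboolP; apply: left_idealbM.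
by apply/asboolP/cyclic_piE; rewrite /cyclic_pi reprK.
Qed.

Fact cyclic_scaleA a b v :
  cyclic_scale a (cyclic_scale b v) = cyclic_scale (a * b) v.
Proof. by have [c ->] := cyclic_pi_surj v; rewrite !cyclic_scaleE mulrA. Qed.

Fact cyclic_scale1 : left_id 1 cyclic_scale.
Proof. by move=> v; have [c ->] := cyclic_pi_surj v; rewrite cyclic_scaleE mul1r. Qed.

Fact cyclic_scaleDr : right_distributive cyclic_scale +%R.
Proof.
move=> a v w; have [b ->] := cyclic_pi_surj v; have [c ->] := cyclic_pi_surj w.
by rewrite -cyclic_piD !cyclic_scaleE mulrDr cyclic_piD.
Qed.

Fact cyclic_scaleDl v : {morph cyclic_scale^~ v : a b / a + b}.
Proof.
move=> a b; have [c ->] := cyclic_pi_surj v.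
by rewrite !cyclic_scaleE mulrDl cyclic_piD.
Qed.

HB.instance Definition _ := GRing.Zmodule_isLmodule.Build A cyclic_module
  cyclic_scaleA cyclic_scale1 cyclic_scaleDr cyclic_scaleDl.

Lemma cyclic_piM a b : cyclic_pi (a * b) = a *: cyclic_pi b.
Proof. by rewrite -[RHS]/(cyclic_scale _ _) cyclic_scaleE. Qed.

End CyclicModule.

Notation free_alg F X := (malg (fmonom X) F).

Definition free_gen (F : fieldType) (X : choiceType) (x : X) : free_alg F X :=
  mkmalgU (fmu x) 1.

(* Only presentations of nonzero algebras are considered, since the trivial
   ring is excluded from [algType]. *)
Record presentation (F : fieldType) := Presentation {
  gens : choiceType;
  rels : free_alg F gens -> Prop;
  rels_proper : ~ two_sided_ideal rels 1
}.

Section PresentedAlgebra.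
Variables (F : fieldType) (P : presentation F).
Local Notation T := (free_alg F (gens P)).

Definition relb : {pred T} := fun a => `[< two_sided_ideal (@rels F P) a >].

Fact relb_zmod_closed : zmod_closed relb.
Proof.
split=> [|a b /asboolP Sa /asboolP Sb]; apply/asboolP; first exact: TI_zero.
exact: TI_sub.
Qed.

HB.instance Definition _ := GRing.isZmodClosed.Build T relb relb_zmod_closed.

Fact relbMl a b : b \in relb -> a * b \in relb.
Proof.
move=> /asboolP Sb; apply/asboolP; elim: Sb a => [b' s c Ss||b1 b2 _ IH1 _ IH2] a.
- by rewrite !mulrA; apply: TI_mul.
- by rewrite mulr0; apply: TI_zero.
- by rewrite mulrBr; apply: TI_sub.
Qed.

Fact relbMr a b : b \in relb -> b * a \in relb.
Proof.
move=> /asboolP Sb; apply/asboolP; elim: Sb a => [b' s c Ss||b1 b2 _ IH1 _ IH2] a.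
- by rewrite -(mulrA (b' * s) c a); apply: TI_mul.
- by rewrite mul0r; apply: TI_zero.
- by rewrite mulrBl; apply: TI_sub.
Qed.

Definition presented_alg : Type := Quotient.quot relb.

HB.instance Definition _ := GRing.Zmodule.on presented_alg.

Definition presented_pi (a : T) : presented_alg := \pi_(Quotient.quot relb) a.

Local Notation pi := presented_pi.

Lemma presented_piE a b :
  pi a = pi b <-> two_sided_ideal (@rels F P) (a - b).
Proof.
rewrite /pi; split=> [/eqP | Sab].
  by rewrite -Quotient.idealrBE => /asboolP.
by apply/eqP; rewrite -Quotient.idealrBE; apply/asboolP.
Qed.

Fact presented_pi_eq a b : (a - b \in relb) = (pi a == pi b).
Proof. exact: Quotient.idealrBE. Qed.

Lemma presented_pi_surj v : exists a, v = pi a.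
Proof. by exists (repr v); rewrite /pi reprK. Qed.

Lemma presented_piD : {morph pi : a b / a + b}.
Proof. by move=> a b; rewrite /pi !piE. Qed.

Definition presented_mul (u v : presented_alg) := pi (repr u * repr v).
Definition presented_scale (c : F) (v : presented_alg) := pi (c *: repr v).

Fact presented_mulE a b : presented_mul (pi a) (pi b) = pi (a * b).
Proof.
have reprB c : repr (pi c) - c \in relb by rewrite presented_pi_eq {1}/pi reprK.
apply/eqP; rewrite -presented_pi_eq.
have -> : repr (pi a) * repr (pi b) - a * b =
    repr (pi a) * (repr (pi b) - b) + (repr (pi a) - a) * b.
  by rewrite mulrBr mulrBl addrA subrK.
by apply: rpredD; [apply: relbMl | apply: relbMr].
Qed.

Fact presented_scaleE c a : presented_scale c (pi a) = pi (c *: a).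
Proof.
apply/eqP; rewrite -presented_pi_eq -scalerBr -mul_malgC; apply: relbMl.
by rewrite presented_pi_eq {1}/pi reprK.
Qed.


Fact presented_mulA : associative presented_mul.
Proof.
move=> u v w; have [a ->] := presented_pi_surj u.
have [b ->] := presented_pi_surj v; have [c ->] := presented_pi_surj w.
by rewrite !presented_mulE mulrA.
Qed.

Fact presented_mul1l : left_id (pi 1) presented_mul.
Proof. by move=> u; have [a ->] := presented_pi_surj u; rewrite presented_mulE mul1r. Qed.

Fact presented_mul1r : right_id (pi 1) presented_mul.
Proof. by move=> u; have [a ->] := presented_pi_surj u; rewrite presented_mulE mulr1. Qed.

Fact presented_mulDl : left_distributive presented_mul +%R.
Proof.
move=> u v w; have [a ->] := presented_pi_surj u.
have [b ->] := presented_pi_surj v; have [c ->] := presented_pi_surj w.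
by rewrite -presented_piD !presented_mulE mulrDl presented_piD.
Qed.

Fact presented_mulDr : right_distributive presented_mul +%R.
Proof.
move=> u v w; have [a ->] := presented_pi_surj u.
have [b ->] := presented_pi_surj v; have [c ->] := presented_pi_surj w.
by rewrite -presented_piD !presented_mulE mulrDr presented_piD.
Qed.

Fact presented_pi0 : pi 0 = 0.
Proof. by apply: (addrI (pi 0)); rewrite -presented_piD !addr0. Qed.

Fact presented_nonzero1 : pi 1 != 0.
Proof.
rewrite -presented_pi0; apply/eqP => /presented_piE; rewrite subr0.
exact: rels_proper.
Qed.

HB.instance Definition _ := GRing.Zmodule_isNzRing.Build presented_alg
  presented_mulA presented_mul1l presented_mul1r presented_mulDl
  presented_mulDr presented_nonzero1.

Fact presented_scaleA c d v :
  presented_scale c (presented_scale d v) = presented_scale (c * d) v.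
Proof. by have [a ->] := presented_pi_surj v; rewrite !presented_scaleE scalerA. Qed.

Fact presented_scale1 : left_id 1 presented_scale.
Proof. by move=> v; have [a ->] := presented_pi_surj v; rewrite presented_scaleE scale1r. Qed.

Fact presented_scaleDr : right_distributive presented_scale +%R.
Proof.
move=> c u v; have [a ->] := presented_pi_surj u; have [b ->] := presented_pi_surj v.
by rewrite -presented_piD !presented_scaleE scalerDr presented_piD.
Qed.

Fact presented_scaleDl v : {morph presented_scale^~ v : c d / c + d}.
Proof.
move=> c d; have [a ->] := presented_pi_surj v.
by rewrite !presented_scaleE scalerDl presented_piD.
Qed.

HB.instance Definition _ := GRing.Zmodule_isLmodule.Build F presented_alg
  presented_scaleA presented_scale1 presented_scaleDr presented_scaleDl.

Lemma presented_piM : {morph pi : a b / a * b}.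
Proof. by move=> a b; rewrite -[RHS]/(presented_mul _ _) presented_mulE. Qed.

Lemma presented_piZ c : {morph pi : a / c *: a}.
Proof. by move=> a; rewrite -[RHS]/(presented_scale _ _) presented_scaleE. Qed.

Fact presented_scaleAl (c : F) (u v : presented_alg) : c *: (u * v) = (c *: u) * v.
Proof.
have [a ->] := presented_pi_surj u; have [b ->] := presented_pi_surj v.
by rewrite -presented_piM -!presented_piZ -presented_piM scalerAl.
Qed.

HB.instance Definition _ :=
  GRing.Lmodule_isLalgebra.Build F presented_alg presented_scaleAl.

Fact free_scaleAr (c : F) (a b : T) : c *: (a * b) = a * (c *: b).
Proof.
apply/malgP => k; rewrite monalg.mcoeffZ mcoeffMl.
rewrite (mcoeffMlw k (fsubset_refl _) (monalg.msuppZ_le c b)) mulr_sumr.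
apply: eq_bigr => k1 _; rewrite mulr_sumr; apply: eq_bigr => k2 _.
by rewrite monalg.mcoeffZ mulrnAr mulrCA.
Qed.

Fact presented_scaleAr (c : F) (u v : presented_alg) : c *: (u * v) = u * (c *: v).
Proof.
have [a ->] := presented_pi_surj u; have [b ->] := presented_pi_surj v.
by rewrite -presented_piM -!presented_piZ -presented_piM free_scaleAr.
Qed.

HB.instance Definition _ :=
  GRing.Lalgebra_isAlgebra.Build F presented_alg presented_scaleAr.

Definition presented_gen (x : gens P) : presented_alg := pi (free_gen F x).

End PresentedAlgebra.

Section EnvelopingAlgebra.
Variables (F : fieldType) (g : lieAlgType F).
Local Notation iota x := (free_gen F (x : g)).

Inductive env_rel : free_alg F g -> Prop :=
| ER_linear c x y : env_rel (iota (c *: x + y) - (c *: iota x + iota y))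
| ER_lie x y : env_rel (iota x * iota y - iota y * iota x - iota (lie x y)).

Fact env_rel_proper : ~ two_sided_ideal env_rel 1.
Proof.
pose eps : free_alg F g -> F := monalg.mcoeff monalg.one.
have epsN u : eps (- u) = - eps u by exact: raddfN.
have epsD u v : eps (u + v) = eps u + eps v by exact: raddfD.
have epsM u v : eps (u * v) = eps u * eps v by exact: rmorphM.
have epsZ c u : eps (c *: u) = c * eps u by exact: monalg.mcoeffZ.
have eps_gen x : eps (iota x) = 0.
  by rewrite /eps monalg.mcoeffU -val_eqE /= fm1 fmU.
have eps_rel w : env_rel w -> eps w = 0.
  by case=> [c x y | x y]; rewrite !(epsD, epsN, epsM, epsZ, eps_gen)
     ?mulr0 ?addr0 !subr0.
suff eps_ideal w : two_sided_ideal env_rel w -> eps w = 0.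
  by move/eps_ideal/eqP; rewrite /eps rmorph1 oner_eq0.
elim=> [a s b /eps_rel s0 | | a b _ a0 _ b0].
- by rewrite !epsM s0 mulr0 mul0r.
- by rewrite /eps raddf0.
- by rewrite epsD epsN a0 b0 subr0.
Qed.

Definition enveloping : algType F :=
  presented_alg (Presentation env_rel_proper).

Definition env_inj (x : g) : enveloping :=
  @presented_gen F (Presentation env_rel_proper) x.

Definition env_central (z : enveloping) : Prop :=
  forall u : enveloping, z * u = u * z.

End EnvelopingAlgebra.

Section WeylAlgebra.
Variables (F : fieldType) (N : nat).
Local Notation T := (free_alg F ('I_N + 'I_N)%type).
Local Notation fx i := (free_gen F (inl i : 'I_N + 'I_N)).
Local Notation fd i := (free_gen F (inr i : 'I_N + 'I_N)).

Inductive weyl_rel : T -> Prop :=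
| WR_xx i j : weyl_rel (fx i * fx j - fx j * fx i)
| WR_dd i j : weyl_rel (fd i * fd j - fd j * fd i)
| WR_dx i j : weyl_rel (fd i * fx j - fx j * fd i - (i == j)%:R).

(* Nontriviality, through the action on polynomials. *)
Fact weyl_rel_proper : ~ two_sided_ideal weyl_rel 1.
Proof.
pose letter (l : 'I_N + 'I_N) (p : {mpoly F[N]}) :=
  match l with inl i => 'X_i * p | inr i => p^`M(i) end.
pose word (s : seq ('I_N + 'I_N)) p := foldr letter p s.
have wordD s : {morph word s : p q / p + q}.
  by move=> p q; elim: s => //= -[] i s -> /=; rewrite ?mulrDr ?mderivD.
have wordZ s c : {morph word s : p / c%:MP * p}.
  move=> p; elim: s => //= -[] i s -> /=; first by rewrite mulrCA.
  by rewrite !mul_mpolyC mderivZ.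
have word0 s : word s 0 = 0 by have := wordZ s 0 0; rewrite mpolyC0 !mul0r.
pose act p (w : T) := monalg.mmap (@mpolyC N F) (fun k : fmonom _ => word k p) w.
have act0 p : act p 0 = 0 by exact: raddf0.
have actA p u v : act p (u + v) = act p u + act p v by exact: raddfD.
have actD p u v : act p (u - v) = act p u - act p v by exact: raddfB.
have actU p c k : act p (mkmalgU k c) = c%:MP * word k p by exact: monalg.mmapU.
have actM p u v : act p (u * v) = act (act p v) u.
  rewrite malgME (big_morph (act p) (actA p) (act0 p)); apply: eq_bigr => k _.
  rewrite (big_morph (act p) (actA p) (act0 p)) /=.
  rewrite [act p v]/act /monalg.mmap (big_morph (word k) (wordD k) (word0 k)) mulr_sumr.
  apply: eq_bigr => l _; rewrite actU fmM wordZ mulrA mpolyCM.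
  by rewrite /word foldr_cat.
have act0r u : act 0 u = 0.
  by rewrite /act /monalg.mmap big1 // => k _; rewrite word0 mulr0.
have act_gen p l : act p (free_gen F l) = letter l p.
  by rewrite /free_gen actU fmU mul1r.
have act1 p : act p 1 = p by rewrite actU mul1r fm1.
have act_rel w p : weyl_rel w -> act p w = 0.
  case=> i j; rewrite !actD !actM !act_gen /=; first by rewrite mulrCA subrr.
    by rewrite mderiv_comm subrr.
  have -> : act p (i == j)%:R = (i == j)%:R * p.
    by case: eqP => _; rewrite ?act1 ?mul1r // mul0r act0.
  rewrite mderivM mderivX mnm1E eq_sym addrK; case: eqP => [->|_].
    have -> : (U_(j) - U_(j) = 0 :> 'X_{1..N})%MM.
      by apply/mnmP => k; rewrite mnmBE subnn mnm0E.
    by rewrite scale1r mpolyX0 subrr.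
  by rewrite scale0r mul0r subrr.
suff act_ideal w : two_sided_ideal weyl_rel w -> forall p, act p w = 0.
  by move/act_ideal/(_ 1)/eqP; rewrite act1 oner_eq0.
elim=> [a s b srel p | p | a b _ a0 _ b0 p].
- by rewrite !actM (act_rel _ _ srel) act0r.
- exact: act0.
- by rewrite actD a0 b0 subr0.
Qed.

Definition weyl : algType F := presented_alg (Presentation weyl_rel_proper).

Definition weyl_x (i : 'I_N) : weyl :=
  @presented_gen F (Presentation weyl_rel_proper) (inl i).
Definition weyl_d (i : 'I_N) : weyl :=
  @presented_gen F (Presentation weyl_rel_proper) (inr i).

Definition weyl_poly : {mpoly F[N]} -> weyl := mmap (GRing.in_alg weyl) weyl_x.

End WeylAlgebra.

(* Taylor coefficients of t e^t / (e^t - 1), computed by the recursion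
   [todd_coefE], i.e. (sum_k todd_coef k t^k) ((e^t - 1) / t) = e^t. *)
Fixpoint todd_seq (F : fieldType) (n : nat) : seq F :=
  if n is k.+1 then
    let s := todd_seq F k in
    rcons s (k`!%:R^-1 - \sum_(j < k) s`_j / ((k - j).+1)`!%:R)
  else [::].

Definition todd_coef (F : fieldType) (k : nat) : F := (todd_seq F k.+1)`_k.

Lemma size_todd_seq F n : size (todd_seq F n) = n.
Proof. by elim: n => //= n IH; rewrite size_rcons IH. Qed.

Lemma nth_todd_seq F n k : (k < n)%N -> (todd_seq F n)`_k = todd_coef F k.
Proof.
elim: n => // n IH; rewrite ltnS leq_eqVlt => /predU1P[-> // | ltkn].
by rewrite /= nth_rcons size_todd_seq ltkn IH.
Qed.

Lemma todd_coefE (F : fieldType) k :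
  \sum_(j < k.+1) todd_coef F j / ((k - j).+1)`!%:R = k`!%:R^-1.
Proof.
rewrite big_ord_recr /= subnn divr1 {2}/todd_coef /= nth_rcons size_todd_seq.
rewrite ltnn eqxx addrC.
under [X in _ - X + _]eq_bigr => j _ do rewrite nth_todd_seq //.
by rewrite subrK.
Qed.

Definition exp_coef (F : fieldType) (k : nat) : F := k`!%:R^-1.

Section Realization.
Variables (F : fieldType) (g : lieAlgType F) (h : {vspace g}).
Variables (N : nat) (alpha : 'I_N -> dual h) (f : N.-tuple g).

(* Elements of F[x] (x) g are row vectors of coordinates in the basis [gbasis]
   of g; linear endomorphisms act on them by right multiplication. *)
Local Notation d := (\dim {:g}).
Local Notation gbasis := (vbasis {:g}).

Definition ext_vec (a : g) : 'rV[{mpoly F[N]}]_d :=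
  \row_j (coord gbasis j a)%:MP.

Definition ext_end (phi : 'End(g)) : 'M[{mpoly F[N]}]_d :=
  \matrix_(i, j) (coord gbasis j (phi gbasis`_i))%:MP.

Definition ext_form (phi : g -> F) (w : 'rV[{mpoly F[N]}]_d) : {mpoly F[N]} :=
  \sum_j w 0 j * (phi gbasis`_j)%:MP.

(* ad(u(x)) for u(x) = sum_i x_i f_i *)
Definition ad_u : 'M[{mpoly F[N]}]_d :=
  \sum_(i < N) 'X_i *: ext_end (ad (tnth f i)).

(* The value of sum_k c_k t^k at t = M. The truncation is exact when M is
   nilpotent, since then M ^+ d = 0. *)
Definition series_at (c : nat -> F) (M : 'M[{mpoly F[N]}]_d) :
    'M[{mpoly F[N]}]_d :=
  \sum_(k < d) (c k)%:MP *: M ^+ k.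

(* e^{-ad(u(x))} a *)
Definition exp_ad_u (a : g) : 'rV[{mpoly F[N]}]_d :=
  ext_vec a *m series_at (exp_coef F) (- ad_u).

Definition pi_vector (a : g) : 'rV[{mpoly F[N]}]_d :=
  exp_ad_u a *m ext_end (proj_nminus alpha) *m series_at (todd_coef F) ad_u.

Definition pi_op (mu : dual h) (a : g) : weyl F N :=
  - \sum_(i < N) weyl_poly (ext_form (coord f i) (pi_vector a)) * weyl_d F i
  + weyl_poly (ext_form
      (fun y => (mu + half_sum alpha) (vsproj h (proj_h alpha y)) : F)
      (exp_ad_u a)).

End Realization.

Inductive gt_gens (F : fieldType) (N : nat) (theta : 'I_N) : weyl F N -> Prop :=
| GT_x i : i != theta -> gt_gens theta (weyl_x F i)
| GT_d : gt_gens theta (weyl_d F theta).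

(* A / I_GT as a left module over the Weyl algebra A; U(g) acts on it through
   the algebra morphism U(g) -> A extending [pi_op (lambda + rho)]. *)
Definition gt_module (F : fieldType) (N : nat) (theta : 'I_N) :
    lmodType (weyl F N) :=
  cyclic_module (@gt_gens F N theta).

Section CentralCharacter.
Variables (F : fieldType) (g : lieAlgType F) (h : {vspace g}).
Variables (N : nat) (alpha : 'I_N -> dual h).

(* U(h) = S(h) is the polynomial algebra on the basis [vbasis h] of h. *)
Local Notation Uh := {mpoly F[\dim h]}.
Local Notation hbasis i := ((vbasis h)`_(nat_of_ord i)).

Definition Uh_inj : Uh -> enveloping g :=
  mmap (GRing.in_alg (enveloping g)) (fun i => env_inj (hbasis i)).

Definition Uh_eval (mu : dual h) (q : Uh) : F :=
  q.@[fun i => mu (vsproj h (hbasis i)) : F].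

(* nminus U(g) + U(g) nplus *)
Inductive hc_complement : enveloping g -> Prop :=
| HC_nminus y u : y \in nminus alpha -> hc_complement (env_inj y * u)
| HC_nplus u x : x \in nplus alpha -> hc_complement (u * env_inj x)
| HC_zero : hc_complement 0
| HC_add u v : hc_complement u -> hc_complement v -> hc_complement (u + v).

(* The projection along U(g) = U(h) (+) (nminus U(g) + U(g) nplus): the element
   q is unique by PBW, and the default value 0 is never used. *)
Definition hc_proj (z : enveloping g) : Uh :=
  xget 0 [set q : Uh | hc_complement (z - Uh_inj q)]%classic.

Definition hc_shift (q : Uh) : Uh :=
  q \mPo [tuple 'X_i - (half_sum alpha (vsproj h (hbasis i)) : F)%:MP
            | i < \dim h].

Definition harish_chandra (z : enveloping g) : Uh := hc_shift (hc_proj z).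

Definition central_char (mu : dual h) (z : enveloping g) : F :=
  Uh_eval mu (harish_chandra z).

End CentralCharacter.

(* Main.v *)
Require Import Defs.
From mathcomp Require Import all_boot all_order all_algebra.
From mathcomp Require Import reals complex.
From mathcomp Require Import boolp.
From mathcomp Require Import -(notations) monalg.
From mathcomp Require Import mpoly.
From mathcomp Require Import ring.

(** A central element [z] acts by the scalar [chi z] already in the Weyl algebra:
    [Pi z = chi z], hence on every module over it. This equality is tested in a
    faithful representation of the Weyl algebra.

    We let the Weyl algebra act from the right on polynomials, x_i by multiplication
    and d_i by minus the partial derivative ([ract]); the action is faithful
    ([ract_faithful]). Through [Pi] the Lie algebra g then acts on C[x] by first order
    operators, the transposes of those of the realization, and C[x] becomes the dual
    of a Verma module of highest weight lambda:
    - [f_i] acts by a vector field equal to the [i]-th partial derivative at the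
      origin ([pi_act_f], [pi_field_f0]). So a set of polynomials that is preserved by
      these fields and whose members vanish at the origin is 0
      ([invariant_vanishing]);
    - [t] in [h] multiplies the monomial x^m, whose weight is a sum of positive roots,
      by (lambda - weight of x^m)(t) ([pi_act_cartan]). The realization involves
      lambda + 2 rho, and the divergence of the field of [t] subtracts 2 rho;
    - the polynomials in the image of nplus vanish at the origin
      ([pi_act_nplus_origin]).
    All of this comes from the lowest terms of the power series in ad(u(x)) and from
    weights: in the field of a vector of weight [b], the coefficient of d_j only
    involves monomials of weight [b + alpha j] ([pi_field_weight]).

    The operator [T] of [z] commutes with g, so it preserves weights. As constants are
    the only polynomials of weight lambda, the value of [T p] at the origin is [c]
    times that of [p] for a constant [c], so the image of [T - c] vanishes at the
    origin and is preserved by the fields of nminus, whence [T = c]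
    ([commuting_scalar]). To find [c], the value of [T 1] at the origin, decompose [z]
    along U(g) = U(h) + (nminus U(g) + U(g) nplus) ([hc_projP]): nminus kills 1, nplus
    is killed by the evaluation at the origin, and U(h) acts on 1 through lambda
    ([vacuum_central_char]).

    That constants are the only polynomials of weight lambda means that a nonempty sum
    of positive roots is not 0 ([root_sum_eq0]). This rests on root strings, that is
    on coroots ([coroot]), which exist because the Killing form of a simple Lie
    algebra with a Cartan subalgebra is nondegenerate ([killing_nondeg]). *)

Set Implicit Arguments.
Unset Strict Implicit.
Unset Printing Implicit Defensive.

Import Order.TTheory GRing.Theory Num.Theory passmx.

Local Open Scope ring_scope.

(** * Weight vectors *)

Section WeightBasis.
Variables (F : fieldType) (g : lieAlgType F) (h : {vspace g}).
Hypothesis h_cartan : cartan_subalgebra h.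

Lemma lieDl (x y z : g) : lie (x + y) z = lie x z + lie y z.
Proof. exact: (raddfD (lier z)). Qed.

Lemma lieDr (x y z : g) : lie x (y + z) = lie x y + lie x z.
Proof. exact: raddfD. Qed.

Lemma lieZl c (x z : g) : lie (c *: x) z = c *: lie x z.
Proof. by rewrite -!/(lier z _) linearZ. Qed.

Lemma lieZr c (x z : g) : lie x (c *: z) = c *: lie x z.
Proof. exact: linearZ. Qed.

Lemma lie0l (x : g) : lie 0 x = 0.
Proof. exact: (raddf0 (lier x)). Qed.

Lemma lie_suml I r (P : pred I) (u : I -> g) y :
  lie (\sum_(i <- r | P i) u i) y = \sum_(i <- r | P i) lie (u i) y.
Proof. exact: (raddf_sum (lier y)). Qed.

Lemma lie_anti (x y : g) : lie x y = - lie y x.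
Proof.
have := lie_alt (x + y); rewrite lieDl !lieDr !lie_alt add0r addr0 => /eqP.
by rewrite addr_eq0 => /eqP.
Qed.

Lemma lie_derivation (t x y : g) : lie t (lie x y) = lie (lie t x) y + lie x (lie t y).
Proof.
have /eqP := lie_jacobi t x y; rewrite -addrA addr_eq0 => /eqP ->.
rewrite opprD addrC; congr (_ + _); first by rewrite [in RHS]lie_anti.
by rewrite [lie y t]lie_anti linearN opprK.
Qed.

Lemma root_spaceE (b : dual h) x t : x \in root_space b -> t \in h ->
  lie t x = (b (vsproj h t) : F) *: x.
Proof. by move=> /root_spaceP /(_ (vsproj h t)) + th; rewrite vsprojK. Qed.

Lemma lie_root_space (b c : dual h) x y :
  x \in root_space b -> y \in root_space c -> lie x y \in root_space (b + c).
Proof.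
move=> xb yc; apply/root_spaceP => t.
have /root_spaceP xbt := xb; have /root_spaceP yct := yc.
by rewrite lie_derivation xbt yct lieZl lieZr add_lfunE scalerDl.
Qed.

Lemma root_space0 : root_space (0 : dual h) = h.
Proof.
have [abel _ selfc] := h_cartan; apply/vspaceP => x; apply/idP/idP => [/root_spaceP x0|xh].
  by apply: selfc => t th; rewrite -(vsprojK th) x0 zero_lfunE scale0r.
by apply/root_spaceP => t; rewrite zero_lfunE scale0r abel // subvsP.
Qed.

Lemma basis_coordK n (b : n.-tuple g) x :
  basis_of fullv b -> x = \sum_(i < n) coord b i x *: b`_i.
Proof. by move/coord_basis; apply; rewrite memvf. Qed.

(** The operators [ad t], [t \in h], commute and are diagonalizable, hence they
    are simultaneously diagonalizable. *)
Lemma weight_basis : exists (e : (\dim {:g}).-tuple g) (w : 'I_(\dim {:g}) -> dual h),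
  basis_of fullv e /\ forall i : 'I_(\dim {:g}), e`_i \in root_space (w i).
Proof.
have [abel diag _] := h_cartan.
pose E := vbasis {:g}.
have bE : basis_of fullv E := vbasisP _.
pose M t := mxof E E (ad t).
have row_mulM t x : rVof E x *m M t = rVof E (lie t x).
  by rewrite mul_mxof rVofK // adE.
have /codiagonalizableP[P Pu /allP PD] :
  {in [seq M t | t <- vbasis h] &, forall A B, comm_mx A B} /\
  (forall A, A \in [seq M t | t <- vbasis h] -> diagonalizable A).
  split.
    move=> _ _ /mapP[s sh ->] /mapP[t th ->].
    have shh := vbasis_mem sh; have thh := vbasis_mem th.
    rewrite /comm_mx /M -!mxof_comp //; congr (mxof _ _ _); apply/lfunP => x.
    rewrite !comp_lfunE !adE lie_derivation.
    by rewrite [lie t s]abel // lie0l add0r.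
  move=> _ /mapP[t th ->]; have [e0 be0 ev] := diag t (vbasis_mem th).
  have size_e : size e0 == \dim {:g} by rewrite eq_sym -(eqP (basis_free be0)) (span_basis be0).
  pose e := Tuple size_e; have be : basis_of fullv e by [].
  pose P : 'M[F]_(\dim {:g}) := \matrix_i rVof E e`_i.
  have Pu : P \in unitmx.
    have /mulmx1_unit[//] : P *m (\matrix_(i < \dim {:g}) rVof e E`_i) = 1%:M.
    apply/matrixP => i k; rewrite !mxE -(coord_free i k (basis_free be)).
    rewrite [in RHS](basis_coordK e`_i bE) linear_sum.
    by apply: eq_bigr => j _; rewrite !mxE linearZ.
  exists P => //; apply/similar_diagPex.
  exists (\row_i coord e i (lie t e`_i)); apply/similarP => //.
  apply/row_matrixP => i; rewrite !row_mul row_diag_mx -scalemxAl -rowE rowK mxE.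
  rewrite row_mulM; have [|c tc] := ev e`_i; first by rewrite mem_nth ?size_tuple.
  by rewrite tc linearZ /= linearZ /= coord_free ?(basis_free be) // eqxx mulr1.
pose e := [tuple vecof E (row i P) | i < \dim {:g}].
have eE (i : 'I_(\dim {:g})) : e`_i = vecof E (row i P).
  by rewrite -tnth_nth tnth_mktuple.
have be : basis_of fullv e.
  rewrite basisEdim size_tuple leqnn andbT; apply/subvP => x _.
  rewrite -(rVofK bE x) -(mulmxKV Pu (rVof E x)) mulmx_sum_row linear_sum.
  apply: memv_suml => i _; rewrite linearZ /= memvZ //.
  by rewrite -eE memv_span // mem_nth // size_tuple.
exists e, (fun i => linfun (coord e i \o (lier e`_i \o vsval) : subvs_of h -> F^o) : dual h).
split=> // i; apply/root_spaceP => t; rewrite lfunE /= /lier.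
have tE : vsval t = \sum_j coord (vbasis h) j (vsval t) *: (vbasis h)`_j.
  exact: coord_vbasis (subvsP t).
have tj (j : 'I_(\dim h)) : exists c, lie (vbasis h)`_j e`_i = c *: e`_i.
  have /PD /similar_diagPex[D /similarP] : M (vbasis h)`_j \in [seq M t | t <- vbasis h].
    by apply: map_f; rewrite mem_nth ?size_tuple.
  move=> /(_ Pu) /(congr1 (row i)); rewrite !row_mul row_diag_mx -scalemxAl -rowE.
  move/(congr1 (vecof E)); rewrite linearZ /= -eE => De; exists (D 0 i).
  by rewrite -De -[row i P](vecofK bE) row_mulM rVofK // -eE.
have [c tc] := fin_all_exists tj.
have -> : lie (vsval t) e`_i = (\sum_j coord (vbasis h) j (vsval t) * c j) *: e`_i.
  rewrite {1}tE lie_suml scaler_suml; apply: eq_bigr => j _.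
  by rewrite lieZl tc scalerA.
by rewrite linearZ /= coord_free ?(basis_free be) // eqxx mulr1.
Qed.

(** Eigenvectors for different characters of [h] are independent, so the
    expansion of a weight vector only involves vectors of the same weight. *)
Lemma coord_weight n (b : n.-tuple g) (w : 'I_n -> dual h) beta x i :
  free b -> (forall j : 'I_n, b`_j \in root_space (w j)) -> x \in <<b>>%VS ->
  x \in root_space beta -> coord b i x != 0 -> w i = beta.
Proof.
move=> fb bw xb /root_spaceP xbeta ci; apply/lfunP => t.
have /(congr1 (coord b i)) := xbeta t.
rewrite [in LHS](coord_span xb) linear_sum.
have -> : \sum_(j < n) lie (vsval t) (coord b j x *: b`_j) =
    \sum_(j < n) (coord b j x * (w j t : F)) *: b`_j.
  apply: eq_bigr => j _; have /root_spaceP bj := bw j.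
  by rewrite lieZr bj scalerA.
by rewrite coord_sum_free // linearZ /= mulrC => /(mulIf ci).
Qed.

End WeightBasis.

(** * The Killing form and coroots *)

Section SimpleRoots.
Variables (F : numFieldType) (g : lieAlgType F) (h : {vspace g}).
Hypothesis g_simple : simple_lie g.
Hypothesis h_cartan : cartan_subalgebra h.

(** Take a subspace of maximal dimension among those contained in [P]. *)
Lemma vspace_of_pred (V : vectType F) (P : V -> Prop) :
  P 0 -> (forall c x y, P x -> P y -> P (c *: x + y)) ->
  exists U : {vspace V}, forall x, x \in U <-> P x.
Proof.
move=> P0 PL; pose Q n := `[< exists U : {vspace V}, \dim U = n /\ forall x, x \in U -> P x >].
have [||n /asboolP[U [dU UP]] nmax] := @ex_maxnP Q (\dim {:V}).
- exists 0%N; apply/asboolP; exists 0%VS; rewrite dimv0; split=> // x.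
  by rewrite memv0 => /eqP ->.
- by move=> n /asboolP[U [<- _]]; apply/dimvS/subvf.
exists U => x; split=> [/UP //|Px].
have UxP y : y \in (U + <[x]>)%VS -> P y.
  move=> /memv_addP[u /UP Pu [_ /vlineP[c ->] ->]].
  by rewrite addrC; apply: PL.
have : (U == U + <[x]>)%VS.
  rewrite eqEdim addvSl dU; apply: nmax; apply/asboolP.
  by exists (U + <[x]>)%VS.
by move=> /eqP ->; apply: (subvP (addvSr _ _)); apply: memv_line.
Qed.

Lemma simple_pred (P : g -> Prop) :
  P 0 -> (forall c x y, P x -> P y -> P (c *: x + y)) ->
  (forall x y, P y -> P (lie x y)) ->
  (forall x, P x -> x = 0) \/ (forall x, P x).
Proof.
move=> P0 PL PI; have [U UP] := vspace_of_pred P0 PL.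
have [|U0|UT] := g_simple.2 U; first by move=> x y /UP ?; apply/UP/PI.
  by left=> x /UP; rewrite U0 memv0 => /eqP.
by right=> x; apply/UP; rewrite UT memvf.
Qed.

Lemma simple_center (t : g) : (forall x, lie x t = 0) -> t = 0.
Proof.
move=> tZ; have [] := @simple_pred (fun t : g => forall x, lie x t = 0).
- by move=> x; rewrite raddf0.
- by move=> c x y xZ yZ z; rewrite lieDr lieZr xZ yZ scaler0 addr0.
- by move=> x y yZ z; rewrite yZ raddf0.
- exact.
- by move=> gZ; have [x [y]] := g_simple.1; rewrite gZ eqxx.
Qed.

Definition is_weight (b : dual h) : bool := root_space b != 0%VS.

Lemma is_weightP (b : dual h) :
  is_weight b <-> exists2 x, x \in root_space b & x != 0.
Proof.
split=> [bw | [x xb x0]].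
  by exists (vpick (root_space b)); rewrite ?memv_pick ?vpick0.
by apply: contraNneq x0 => b0; rewrite -memv0 -b0.
Qed.

Section Basis.
Variables (e : (\dim {:g}).-tuple g) (w : 'I_(\dim {:g}) -> dual h).
Hypothesis e_basis : basis_of fullv e.
Hypothesis e_weight : forall i : 'I_(\dim {:g}), e`_i \in root_space (w i).

Lemma coord_root_space b x i : x \in root_space b -> coord e i x != 0 -> w i = b.
Proof.
apply: coord_weight (basis_free e_basis) e_weight _.
by rewrite (span_basis e_basis) memvf.
Qed.

Lemma is_weight_in b : is_weight b -> exists i, w i = b.
Proof.
move=> /is_weightP[x xb x0].
have [i ci] : exists i, coord e i x != 0.
  apply/existsP; apply: contraNT x0 => /existsPn c0.
  rewrite (basis_coordK x e_basis) big1 // => i _.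
  by move: (c0 i); rewrite negbK => /eqP ->; rewrite scale0r.
by exists i; apply: coord_root_space ci.
Qed.

Lemma dual_mulrnI (a : dual h) m n : a != 0 -> a *+ m = a *+ n -> m = n.
Proof.
move=> a0 /eqP; rewrite -!scaler_nat -subr_eq0 -scalerBl scaler_eq0 (negbTE a0) orbF.
by rewrite subr_eq0 eqr_nat => /eqP.
Qed.

Lemma string_end (a b : dual h) : a != 0 -> exists k, ~ is_weight (b + a *+ k).
Proof.
move=> a0; have [//|all_w] := pselect (exists k, ~ is_weight (b + a *+ k)).
have wk (k : 'I_(\dim {:g}).+1) : exists i, w i = b + a *+ k.
  by apply: is_weight_in; apply: contrapT => nw; apply: all_w; exists k.
have [u uE] := fin_all_exists wk.
have uI : injective u.
  move=> k l ukl; apply/val_inj/(dual_mulrnI a0)/(addrI b).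
  by rewrite -!uE ukl.
by have := leq_card u uI; rewrite !card_ord ltnn.
Qed.

Lemma ad_weight0 t : t \in h -> (forall i, w i (vsproj h t) = 0) -> t = 0.
Proof.
move=> th t0; apply: simple_center => x; rewrite lie_anti.
rewrite (basis_coordK x e_basis) linear_sum big1 ?oppr0 //= => i _.
by rewrite lieZr (root_spaceE (e_weight i) th) t0 scale0r scaler0.
Qed.

Section Coroot.
Variables (a : dual h) (x y : g).
Hypothesis a0 : a != 0.
Hypotheses (xa : x \in root_space a) (ya : y \in root_space (- a)).
Let t := lie x y.
Let th : t \in h.
Proof. by have := lie_root_space xa ya; rewrite subrr root_space0. Qed.
Let ev (b : dual h) : F := b (vsproj h t).

(** The sl2 computation: on [u k = y^k v] one has [x u_(k+1) = c_k u_k] with an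
    explicit [c_k]; the string is finite because its weights are distinct, and
    [c_k] vanishes at its end. As [x], [y] are not normalized and [a t] may still be
    0, the conclusion is stated relative to [ev a]. *)
Lemma highest_weight b v : v \in root_space b -> v != 0 -> lie x v = 0 ->
  exists m, ev b = m%:R / 2 * ev a.
Proof.
move=> vb v0 xv; pose u k := iter k (lie y) v.
have ub k : u k \in root_space (b - a *+ k).
  elim: k => [|k IHk]; first by rewrite subr0.
  by have := lie_root_space ya IHk; rewrite addrCA -opprD -mulrS.
have evk k : (b - a *+ k) (vsproj h t) = ev b - k%:R * ev a.
  by rewrite add_lfunE opp_lfunE -scaler_nat scale_lfunE.
have xu k : lie x (u k.+1) = (k.+1%:R * ev b - 'C(k.+1, 2)%:R * ev a) *: u k.
  elim: k => [|k IHk].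
    rewrite /= lie_derivation xv raddf0 addr0 (root_spaceE vb) //.
    by rewrite mul0r subr0 mul1r.
  rewrite [u k.+2]/= lie_derivation -/(u k.+1) IHk lieZr -/(u k.+1) -/t.
  rewrite (root_spaceE (ub k.+1)) // evk -scalerDl; congr (_ *: _).
  rewrite [in RHS]binS bin1 natrD; ring.
have u_fin : exists k, u k == 0.
  have [k kw] : exists k, ~ is_weight (b + (- a) *+ k) by apply: string_end; rewrite oppr_eq0.
  exists k; apply: contra_notT kw => uk; apply/is_weightP; exists (u k); rewrite ?mulNrn //.
have [[|m] um umin] := ex_minnP u_fin; first by case/negP: v0.
exists m; have um0 : u m != 0 by apply/negP => /umin; rewrite ltnn.
have /eqP := xu m; rewrite (eqP um) raddf0 eq_sym scaler_eq0 (negbTE um0) orbF.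
rewrite subr_eq0 => /eqP bm.
have m1 : m.+1%:R != 0 :> F by rewrite pnatr_eq0.
apply: (mulfI m1); rewrite bm !mulrA; congr (_ * _).
by rewrite -natrM -[X in (_ * X)%N]bin1 mul_bin_diag natrM mulrC mulKf ?pnatr_eq0.
Qed.

Lemma weight_top b : is_weight b -> ~ is_weight (b + a) -> exists m, ev b = m%:R / 2 * ev a.
Proof.
move=> /is_weightP[v vb v0] bw; apply: (highest_weight vb v0).
have [//|/eqP xv] := eqVneq (lie x v) 0; case: bw; apply/is_weightP.
by exists (lie x v); [rewrite addrC; apply: lie_root_space | apply/eqP].
Qed.

(** Go up the string of [b] in the direction [a] to its top weight. *)
Lemma weight_real b : is_weight b -> exists2 r, r \is Num.real & ev b = r * ev a.
Proof.
move=> bw; have [k0 nw] := string_end b a0.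
have ex_end : exists k, `[< ~ is_weight (b + a *+ k) >] by exists k0; apply/asboolP.
have [[|k] /asboolP kw kmin] := ex_minnP ex_end; first by case: kw; rewrite addr0.
have bk : is_weight (b + a *+ k).
  by apply: contrapT => /asboolP /kmin; rewrite ltnn.
have [|m] := weight_top bk; first by rewrite -addrA -mulrSr.
rewrite /ev add_lfunE -scaler_nat scale_lfunE => /eqP; rewrite eq_sym -subr_eq => /eqP <-.
exists (m%:R / 2 - k%:R); last by rewrite mulrBl.
by rewrite rpredB ?rpred_div ?realn.
Qed.

(** If [a] vanished on [t], so would all weights, and [t] would be central. *)
Lemma coroot_neq0 : t != 0 -> ev a != 0.
Proof.
apply: contraNneq => a_t; apply/eqP/ad_weight0 => // i.
have [|r _] := @weight_real (w i).
  apply/is_weightP; exists e`_i => //.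
  by apply: (basis_not0 e_basis); rewrite mem_nth ?size_tuple.
by rewrite a_t mulr0.
Qed.

End Coroot.

Definition ad_mx x := mxof e e (ad x).
Definition killing x y := \tr (ad_mx x *m ad_mx y).

Lemma ad_mxL c x y : ad_mx (c *: x + y) = c *: ad_mx x + ad_mx y.
Proof.
rewrite /ad_mx -linearP; congr (mxof e e _); apply/lfunP => z.
by rewrite add_lfunE scale_lfunE !adE lieDl lieZl.
Qed.

Lemma ad_mxB x y : ad_mx (lie x y) = ad_mx y *m ad_mx x - ad_mx x *m ad_mx y.
Proof.
rewrite /ad_mx -!mxof_comp // -linearB; congr (mxof e e _); apply/lfunP => z.
rewrite add_lfunE opp_lfunE !comp_lfunE !adE (lie_derivation x y z).
by rewrite addrK.
Qed.

Lemma killingC x y : killing x y = killing y x.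
Proof. exact: mxtrace_mulC. Qed.

Lemma killing_invariant x y z : killing (lie x y) z = killing x (lie y z).
Proof.
rewrite /killing !ad_mxB mulmxBl mulmxBr !linearB /= !mulmxA; congr (_ - _).
by rewrite -[in LHS]mulmxA mxtrace_mulC.
Qed.

Lemma killingL c x y z : killing (c *: x + y) z = c * killing x z + killing y z.
Proof. by rewrite /killing ad_mxL mulmxDl -scalemxAl linearP. Qed.

Lemma killing0 z : killing 0 z = 0.
Proof.
by have /eqP := killingL 1 0 0 z; rewrite scaler0 add0r mul1r addrC -subr_eq subrr => /eqP <-.
Qed.

Lemma killingN x z : killing (- x) z = - killing x z.
Proof. by have := killingL (-1) x 0 z; rewrite killing0 !addr0 scaleN1r mulN1r. Qed.

Lemma killingZ c x z : killing (c *: x) z = c * killing x z.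
Proof. by have := killingL c x 0 z; rewrite killing0 !addr0. Qed.

Lemma basis_pred (P : g -> Prop) : P 0 -> (forall c x y, P x -> P y -> P (c *: x + y)) ->
  (forall i : 'I_(\dim {:g}), P e`_i) -> forall x, P x.
Proof.
move=> P0 PL Pe x; rewrite (basis_coordK x e_basis).
elim/big_rec: _ => // i y _ Py; exact: PL.
Qed.

Lemma killing_weight t : t \in h ->
  killing t t = \sum_i (w i (vsproj h t) : F) ^+ 2.
Proof.
move=> th; rewrite /killing /ad_mx -mxof_comp //; apply: eq_bigr => i _.
rewrite !mxE /= vecof_delta comp_lfunE !adE (root_spaceE (e_weight i) th).
rewrite lieZr (root_spaceE (e_weight i) th) scalerA linearZ /=.
by rewrite coord_free ?(basis_free e_basis) // eqxx mulr1 expr2.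
Qed.

Lemma basis_weight i : is_weight (w i).
Proof.
apply/is_weightP; exists e`_i => //.
by apply: (basis_not0 e_basis); rewrite mem_nth ?size_tuple.
Qed.

(** If the Killing form vanished, the values of the weights on a bracket [t] of
    opposite root vectors would be real multiples of one number with squares of
    sum 0, so [t = 0]. But then the weight vectors of nonzero weight would span an
    ideal (the predicate [J]): if it is 0 then [g = h] is abelian, and if it is [g]
    then [h = 0] is its own centralizer, so [g = 0]. *)
Lemma killing_neq0 : exists x y, killing x y != 0.
Proof.
apply: contrapT => k0.
have {}k0 x y : killing x y = 0.
  by apply/eqP; apply: contrapT => kxy; apply: k0; exists x, y; apply/negP.
have opp0 (a : dual h) (x y : g) : a != 0 -> x \in root_space a -> y \in root_space (- a) -> lie x y = 0.
  move=> a0 xa ya; set t := lie x y.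
  have th : t \in h by have := lie_root_space xa ya; rewrite subrr root_space0.
  have [//|t0] := eqVneq t 0; apply: ad_weight0 => // i.
  have at0 := coroot_neq0 a0 xa ya t0; rewrite -/t in at0.
  have wr j : exists r, r \is Num.real /\ w j (vsproj h t) = r * (a (vsproj h t) : F).
    by have [r] := weight_real a0 xa ya (basis_weight j); exists r.
  have [r rE] := fin_all_exists wr.
  have /eqP := k0 t t; rewrite killing_weight //.
  under eq_bigr => j _ do rewrite (rE j).2 exprMn.
  rewrite -mulr_suml mulf_eq0 expf_eq0 (negbTE at0) orbF psumr_eq0; last first.
    by move=> j _; rewrite real_exprn_even_ge0 ?(rE j).1.
  move=> /allP /(_ i (mem_index_enum i)); rewrite expf_eq0 /= => /eqP ri.
  by rewrite (rE i).2 ri mul0r.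
pose J x := forall i, w i = 0 -> coord e i x = 0.
have eJ i : w i != 0 -> J e`_i.
  move=> wi j wj; rewrite coord_free ?(basis_free e_basis) //.
  by have [ij|//] := eqVneq j i; move: wi; rewrite -ij wj eqxx.
have [x0 [y0 /eqP xy0]] := g_simple.1; apply: xy0.
have [||x y Jy|J0|JT] := @simple_pred J.
- by move=> i _; rewrite linear0.
- by move=> c x y Jx Jy i wi; rewrite linearP /= Jx // Jy // mulr0 addr0.
- move: y Jy; apply: (@basis_pred (fun x => forall y, J y -> J (lie x y))) x.
  + by move=> y _ i _; rewrite lie0l linear0.
  + by move=> c x y Hx Hy z Jz i wi; rewrite lieDl lieZl linearP /= Hx // Hy // mulr0 addr0.
  + move=> k y Jy i wi; rewrite (basis_coordK y e_basis) linear_sum linear_sum big1 //= => j _.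
    rewrite lieZr linearZ /=.
    have [wj|wj] := eqVneq (w j) 0; first by rewrite Jy ?mul0r.
    have ekj := lie_root_space (e_weight k) (e_weight j).
    have [c0|cN] := eqVneq (coord e i (lie e`_k e`_j)) 0; first by rewrite c0 mulr0.
    have /esym/eqP := coord_root_space ekj cN.
    rewrite wi addr_eq0 => /eqP wkj.
    rewrite (opp0 _ _ _ _ (e_weight k)) ?linear0 ?mulr0 ?wkj ?oppr_eq0 ?opprK //.
- have [abel _ _] := h_cartan; have gh x : x \in h.
    rewrite (basis_coordK x e_basis) memv_suml // => i _; apply: memvZ.
    have [wi|/eJ/J0 ei] := eqVneq (w i) 0; last by rewrite ei mem0v.
    by rewrite -(root_space0 h_cartan) -wi.
  exact: abel.
- have [_ _ selfc] := h_cartan; have h0 x : x \in h -> x = 0.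
    rewrite -(root_space0 h_cartan) => xh; rewrite (basis_coordK x e_basis) big1 // => i _.
    have [->|/(coord_root_space xh) wi] := eqVneq (coord e i x) 0; first by rewrite scale0r.
    have := JT e`_i i wi; rewrite coord_free ?(basis_free e_basis) // eqxx => /eqP.
    by rewrite oner_eq0.
  by rewrite [x0]h0 ?lie0l //; apply: selfc => t /h0 ->; rewrite lie0l.
Qed.

Lemma killing_nondeg x : (forall y, killing x y = 0) -> x = 0.
Proof.
move=> kx; have [||y z kz|//|k0] := @simple_pred (fun x => forall y, killing x y = 0) _ _ _.
- exact: killing0.
- by move=> c y z ky kz u; rewrite killingL ky kz mulr0 addr0.
- by move=> u; rewrite killingC -killing_invariant killingC kz.
- exact.
- by have [y [z]] := killing_neq0; rewrite k0 eqxx.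
Qed.

(** A basis vector [y] of weight [b] not orthogonal to [x] has [b = - a] by
    invariance, and then the form of [t] with the bracket is [a t] times a nonzero
    number. *)
Lemma opposite_bracket_neq0 (a : dual h) : a != 0 -> is_weight a ->
  exists x y, [/\ x \in root_space a, y \in root_space (- a) & lie x y != 0].
Proof.
move=> a0 /is_weightP[x xa x0].
have [i ki] : exists i : 'I_(\dim {:g}), killing x e`_i != 0.
  apply: contrapT => nk; case/eqP: x0; apply: killing_nondeg => y; rewrite killingC.
  apply: (@basis_pred (fun y => killing y x = 0)) y.
  - exact: killing0.
  - by move=> c y z ky kz; rewrite killingL ky kz mulr0 addr0.
  - move=> i; apply/eqP; rewrite killingC; apply: contrapT => /negP ki.
    by apply: nk; exists i.
have wi : w i = - a.
  apply/eqP; rewrite -addr_eq0; apply/eqP/lfunP => t; rewrite add_lfunE zero_lfunE.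
  apply: (mulIf ki); rewrite mul0r mulrDl.
  have /root_spaceP et := e_weight i; have /root_spaceP xt := xa.
  have -> : (w i t : F) * killing x e`_i = killing x (lie (vsval t) e`_i).
    by rewrite et [in RHS]killingC killingZ killingC.
  have -> : (a t : F) * killing x e`_i = killing (lie (vsval t) x) e`_i.
    by rewrite xt killingZ.
  by rewrite -killing_invariant lie_anti killingN addNr.
exists x, e`_i; split=> //; first by rewrite -wi.
have [t at0] : exists t, (a t : F) != 0.
  apply: contrapT => nt; case/eqP: a0; apply/lfunP => t; rewrite zero_lfunE.
  by apply/eqP; apply: contrapT => /negP at0; apply: nt; exists t.
apply: contraNneq (mulf_neq0 at0 ki) => xe.
have /root_spaceP xt := xa.
by rewrite -killingZ -xt killing_invariant xe killingC killing0.
Qed.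

End Basis.

(** The coroot of [a]. A weight at the top of its string in the direction [a] is a
    highest weight of sl2, whence the inequality. *)
Lemma coroot (a : dual h) : a != 0 -> is_weight a -> exists t : subvs_of h,
  (a t : F) = 2 /\ forall b, is_weight b -> ~ is_weight (b + a) -> 0 <= (b t : F).
Proof.
have [e [w [eb ew]]] := weight_basis h_cartan.
move=> a0 aw; have [x [y [xa ya xy0]]] := opposite_bracket_neq0 eb ew a0 aw.
have at0 := coroot_neq0 eb ew a0 xa ya xy0.
set s := vsproj h _ in at0; exists ((2 / (a s : F)) *: s); split=> [|b bw nbw].
  by rewrite linearZ /= -[X in X = _]/(2 / _ * _) divfK.
have [m bE] := weight_top eb ew a0 xa ya bw nbw.
rewrite linearZ /= -[X in 0 <= X]/(2 / _ * _) bE -/s.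
have -> : 2 / (a s : F) * (m%:R / 2 * (a s : F)) = m%:R by field.
exact: ler0n.
Qed.

End SimpleRoots.

(** * Positive systems and the triangular decomposition *)

Lemma daddv_pi_eq0 (K : fieldType) (V : vectType K) (U W : {vspace V}) v :
  (U :&: W = 0)%VS -> v \in W -> daddv_pi U W v = 0.
Proof.
move=> UW0 vW; have := daddv_pi_add UW0 (subvP (addvSr U W) v vW).
rewrite (@daddv_pi_id _ _ W U) // 1?capvC // => /eqP.
by rewrite -[X in _ == X]add0r => /eqP/addIr.
Qed.

Section PositiveRootSpaces.
Variables (F : numFieldType) (g : lieAlgType F) (h : {vspace g}).
Hypothesis g_simple : simple_lie g.
Hypothesis h_cartan : cartan_subalgebra h.
Variables (N : nat) (alpha : 'I_N -> dual h) (f : N.-tuple g).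
Hypothesis alpha_pos : positive_system alpha.
Hypothesis f_basis : root_basis alpha f.

Let nbar := nminus alpha.
Let npos := nplus alpha.

Lemma f_weight (i : 'I_N) : f`_i \in root_space (- alpha i).
Proof. by have := f_basis.2 i; rewrite (tnth_nth 0). Qed.

Lemma f_mem (i : 'I_N) : f`_i \in f.
Proof. by rewrite mem_nth ?size_tuple. Qed.

Lemma neg_root_weight i : is_weight (- alpha i).
Proof.
apply/is_weightP; exists f`_i; first exact: f_weight.
exact: (basis_not0 f_basis.1 (f_mem i)).
Qed.

Lemma root_weight i : is_weight (alpha i).
Proof. by have [_ /(_ i)[[_ /eqP]]] := alpha_pos. Qed.

Lemma root_neq0 i : alpha i != 0.
Proof. by have [_ /(_ i)[[]]] := alpha_pos. Qed.

Lemma root_neq_opp i j : alpha i != - alpha j.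
Proof. by have [_ /(_ j)[_ /(_ i)] + _ _] := alpha_pos => /eqP. Qed.

Lemma rootDK i j : is_weight (alpha i + alpha j) -> exists k, alpha k = alpha i + alpha j.
Proof.
move=> ijw; have [_ _ _ addR] := alpha_pos; apply: addR; split; last exact/eqP.
by rewrite addr_eq0 root_neq_opp.
Qed.

(** Positive systems are defined here without a linear order, so this is where
    positivity enters. Evaluate the relation on the coroot of the first root [i]:
    some later entry [j] takes a negative value, so it is not at the top of its string
    and [alpha i + alpha j] is a root. Replacing both roots by their sum gives a
    shorter relation. *)
Lemma root_sum_eq0 (s : seq 'I_N) : \sum_(i <- s) alpha i = 0 -> s = [::].
Proof.
have [n] := ubnP (size s); elim: n s => // n IHn [|i s] //; rewrite ltnS => size_s.
rewrite big_cons => sum0; exfalso.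
have [t [it tpos]] := coroot g_simple h_cartan (root_neq0 i) (root_weight i).
have [j js jiw] : exists2 j, j \in s & is_weight (alpha j + alpha i).
  apply: contrapT => no_j.
  have : 0 < ((alpha i + \sum_(j <- s) alpha j : dual h) t : F).
    rewrite add_lfunE it sum_lfunE ltr_wpDr //.
    rewrite big_seq sumr_ge0 // => j js; apply: tpos; first exact: root_weight.
    by move=> jw; apply: no_j; exists j.
  by rewrite sum0 zero_lfunE ltxx.
have [k kE] := rootDK jiw.
have := IHn (k :: rem j s); rewrite /= size_rem // prednK; last by case: (s) js.
move=> /(_ size_s); rewrite big_cons kE [alpha j + _]addrC -addrA.
by move: sum0; rewrite (big_rem j js) => /= -> /(_ erefl).
Qed.

(** The weight of the monomial x^m, a polynomial function on nminus: the
    coordinate x_i has the weight opposite to that of f_i. *)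
Definition xweight (m : 'X_{1..N}) : dual h := \sum_i alpha i *+ m i.

Lemma xweightD m1 m2 : xweight (m1 + m2)%MM = xweight m1 + xweight m2.
Proof. by rewrite -big_split; apply: eq_bigr => i _; rewrite mnmDE mulrnDr. Qed.

Lemma xweight0 : xweight 0%MM = 0.
Proof. by rewrite /xweight big1 // => i _; rewrite mnm0E. Qed.

Lemma xweightU i : xweight U_(i)%MM = alpha i.
Proof.
rewrite /xweight (bigD1 i) //= mnm1E eqxx big1 ?addr0 // => j ji.
by rewrite mnm1E eq_sym (negbTE ji).
Qed.

Lemma xweight_eq0 m : xweight m = 0 -> m = 0%MM.
Proof.
move=> m0; pose s := flatten [seq nseq (m i) i | i <- index_enum 'I_N].
have s0 : s = [::].
  apply: root_sum_eq0; apply: etrans m0; rewrite big_flatten big_map; apply: eq_bigr => i _.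
  by rewrite big_nseq -Monoid.iteropE.
apply/mnmP => i; rewrite mnm0E; apply/eqP; rewrite eqn0Ngt; apply/negP => mi.
have : i \in s by apply/flatten_mapP; exists i; rewrite ?mem_index_enum // mem_nseq mi eqxx.
by rewrite s0.
Qed.

Lemma root_nminus i x : x \in root_space (- alpha i) -> x \in nbar.
Proof. by apply/subvP; apply: (sumv_sup i). Qed.

Lemma root_nplus i x : x \in root_space (alpha i) -> x \in npos.
Proof. by apply/subvP; apply: (sumv_sup i). Qed.

Lemma weight_cases b : is_weight b ->
  [\/ b = 0, exists i, b = alpha i | exists i, b = - alpha i].
Proof.
move=> bw; have [->|b0] := eqVneq b 0; first by constructor 1.
have [_ _ all_roots _] := alpha_pos.
by have [|i [->|->]] := all_roots b; [split=> //; apply/eqP | constructor 2; exists i | constructor 3; exists i].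
Qed.

Lemma root_decomposition x : exists y t z,
  [/\ y \in nbar, t \in h, z \in npos & x = y + t + z].
Proof.
have [e [w [eb ew]]] := weight_basis h_cartan.
apply: (basis_pred eb (P := fun x => exists y t z, [/\ y \in nbar, t \in h, z \in npos & x = y + t + z])) x.
- by exists 0, 0, 0; rewrite !mem0v !addr0.
- move=> c _ _ [y [t [z [yn th zn ->]]]] [y' [t' [z' [yn' th' zn' ->]]]].
  exists (c *: y + y'), (c *: t + t'), (c *: z + z').
  rewrite !memvD ?memvZ //; split=> //.
  by rewrite !scalerDr addrACA [in LHS](addrACA (c *: y)).
- move=> i; have [wi|[j wi]|[j wi]] := weight_cases (basis_weight eb ew i).
  + exists 0, e`_i, 0; rewrite !mem0v add0r addr0 -(root_space0 h_cartan) -wi.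
    by split.
  + exists 0, 0, e`_i; rewrite !mem0v !add0r; split=> //.
    by apply: (@root_nplus j); rewrite -wi.
  + exists e`_i, 0, 0; rewrite !mem0v !addr0; split=> //.
    by apply: (@root_nminus j); rewrite -wi.
Qed.

Section Supports.
Variables (e : (\dim {:g}).-tuple g) (w : 'I_(\dim {:g}) -> dual h).
Hypothesis e_basis : basis_of fullv e.
Hypothesis e_weight : forall i : 'I_(\dim {:g}), e`_i \in root_space (w i).

Lemma coord_sum_root_space (c : 'I_N -> dual h) x i :
  x \in (\sum_(j < N) root_space (c j))%VS -> (forall j, w i != c j) -> coord e i x = 0.
Proof.
move=> /memv_sumP[u uc ->] ic; rewrite linear_sum big1 // => j _.
apply/eqP; apply: contraT => cN; have := ic j.
by rewrite (coord_root_space e_basis e_weight (uc j isT) cN) eqxx.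
Qed.

Lemma coord_cartan x i : x \in h -> w i != 0 -> coord e i x = 0.
Proof.
move=> xh; have x0 : x \in root_space (0 : dual h) by rewrite root_space0.
by apply: contraNeq => cN; rewrite (coord_root_space e_basis e_weight x0 cN).
Qed.

Lemma coord_eq0 x : (forall i, coord e i x = 0) -> x = 0.
Proof.
by move=> c0; rewrite (basis_coordK x e_basis) big1 // => i _; rewrite c0 scale0r.
Qed.

End Supports.

Lemma nminus_disjoint : (nbar :&: (h + npos) = 0)%VS.
Proof.
have [e [w [eb ew]]] := weight_basis h_cartan.
apply/eqP; rewrite -subv0; apply/subvP => x /memv_capP[xn /memv_addP[t th [z zn xE]]].
rewrite memv0; apply/eqP/(coord_eq0 eb) => i.
have [[j wi]|nj] := pselect (exists j, w i = - alpha j); last first.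
  by apply: (coord_sum_root_space eb ew xn) => j; apply/eqP => wi; apply: nj; exists j.
rewrite xE linearD /= (coord_cartan eb ew th) ?wi ?oppr_eq0 ?root_neq0 //.
rewrite (coord_sum_root_space eb ew zn) ?addr0 // => k.
by rewrite wi eq_sym root_neq_opp.
Qed.

Lemma cartan_disjoint : (h :&: (nbar + npos) = 0)%VS.
Proof.
have [e [w [eb ew]]] := weight_basis h_cartan.
apply/eqP; rewrite -subv0; apply/subvP => x /memv_capP[xh /memv_addP[y yn [z zn xE]]].
rewrite memv0; apply/eqP/(coord_eq0 eb) => i.
have [wi|wi] := eqVneq (w i) 0; last exact: (coord_cartan eb ew).
rewrite xE linearD /= (coord_sum_root_space eb ew yn) => [|k]; last first.
  by rewrite wi eq_sym oppr_eq0 root_neq0.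
rewrite add0r (coord_sum_root_space eb ew zn) // => k.
by rewrite wi eq_sym root_neq0.
Qed.

Lemma proj_nminusE y t z : y \in nbar -> t \in h -> z \in npos ->
  proj_nminus alpha (y + t + z) = y.
Proof.
move=> yn th zn; rewrite /proj_nminus -addrA linearD /= daddv_pi_id ?nminus_disjoint //.
by rewrite daddv_pi_eq0 ?addr0 ?nminus_disjoint ?memv_add.
Qed.

Lemma proj_hE y t z : y \in nbar -> t \in h -> z \in npos ->
  proj_h alpha (y + t + z) = t.
Proof.
move=> yn th zn; rewrite /proj_h addrAC addrC linearD /= daddv_pi_id ?cartan_disjoint //.
by rewrite daddv_pi_eq0 ?addr0 ?cartan_disjoint ?memv_add.
Qed.

Lemma proj_nminus_id y : y \in nbar -> proj_nminus alpha y = y.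
Proof. by move=> yn; rewrite -{1}[y]addr0 -{1}[y]addr0 proj_nminusE ?mem0v. Qed.

Lemma proj_nminus_cartan t : t \in h -> proj_nminus alpha t = 0.
Proof. by move=> th; rewrite -{1}[t]addr0 -{1}[t]add0r proj_nminusE ?mem0v. Qed.

Lemma proj_nminus_nplus z : z \in npos -> proj_nminus alpha z = 0.
Proof. by move=> zn; rewrite -{1}[z]add0r -{1}[0]addr0 proj_nminusE ?mem0v. Qed.

Lemma proj_h_nminus y : y \in nbar -> proj_h alpha y = 0.
Proof. by move=> yn; rewrite -{1}[y]addr0 -{1}[y]addr0 proj_hE ?mem0v. Qed.

Lemma proj_h_id t : t \in h -> proj_h alpha t = t.
Proof. by move=> th; rewrite -{1}[t]addr0 -{1}[t]add0r proj_hE ?mem0v. Qed.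

Lemma proj_h_nplus z : z \in npos -> proj_h alpha z = 0.
Proof. by move=> zn; rewrite -{1}[z]add0r -{1}[0]addr0 proj_hE ?mem0v. Qed.

Lemma proj_nminus_weight (b : dual h) x : x \in root_space b -> proj_nminus alpha x \in root_space b.
Proof.
move=> xb; have [->|x0] := eqVneq x 0; first by rewrite linear0 mem0v.
have bw : is_weight b by apply/is_weightP; exists x.
have [b0|[i bi]|[i bi]] := weight_cases bw.
- have xh : x \in h by rewrite -(root_space0 h_cartan) -b0.
  by rewrite proj_nminus_cartan ?mem0v.
- by rewrite proj_nminus_nplus ?mem0v //; apply: (@root_nplus i); rewrite -bi.
- by rewrite proj_nminus_id //; apply: (@root_nminus i); rewrite -bi.
Qed.

(** If [- alpha i - alpha j] were a positive root [alpha k], then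
    [alpha k + alpha i = - alpha j] would be a root, and a positive one since
    positive systems are closed. *)
Lemma nminus_lie x y : x \in nbar -> y \in nbar -> lie x y \in nbar.
Proof.
move=> /memv_sumP[u uw ->] /memv_sumP[v vw ->].
rewrite lie_suml; apply: memv_suml => i _; rewrite linear_sum; apply: memv_suml => j _ /=.
have ij := lie_root_space (uw i isT) (vw j isT).
have [->|x0] := eqVneq (lie (u i) (v j)) 0; first by rewrite mem0v.
have ijw : is_weight (- alpha i - alpha j) by apply/is_weightP; exists (lie (u i) (v j)).
have [/eqP|[k ijk]|[k ijk]] := weight_cases ijw.
- by rewrite addr_eq0 opprK eq_sym (negbTE (root_neq_opp j i)).
- have : is_weight (alpha k + alpha i) by rewrite -ijk addrAC addNr add0r neg_root_weight.
  move=> /rootDK[l]; rewrite -ijk addrAC addNr add0r => /eqP.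
  by rewrite (negbTE (root_neq_opp l j)).
- by apply: (@root_nminus k); rewrite -ijk.
Qed.

Lemma nplus_lie_cartan t z : t \in h -> z \in npos -> lie t z \in npos.
Proof.
move=> th /memv_sumP[u uw ->]; rewrite linear_sum; apply: memv_suml => i _ /=.
by rewrite (root_spaceE (uw i isT) th) memvZ // (@root_nplus i) // uw.
Qed.

Lemma f_nminus i : f`_i \in nbar.
Proof. by have [i_lt|i_ge] := ltnP i N; [apply: (basis_mem f_basis.1); rewrite mem_nth ?size_tuple
  | rewrite nth_default ?mem0v ?size_tuple]. Qed.

Lemma f_lie_cartan (i : 'I_N) t : t \in h -> lie f`_i t = (alpha i (vsproj h t) : F) *: f`_i.
Proof.
by move=> th; rewrite lie_anti (root_spaceE (f_weight i) th) opp_lfunE scaleNr opprK.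
Qed.

Lemma coord_f_weight (b : dual h) y i : y \in nbar -> y \in root_space b -> coord f i y != 0 ->
  - alpha i = b.
Proof.
move=> yn yb; apply: (coord_weight (basis_free f_basis.1) (w := fun i => - alpha i)) => //.
  by move=> j; apply: f_weight.
by rewrite (span_basis f_basis.1).
Qed.

End PositiveRootSpaces.

(** * Coefficients of polynomial vectors in g *)

Section VectorCoefficients.
Variables (F : fieldType) (g : lieAlgType F) (N : nat) (f : N.-tuple g).
Local Notation d := (\dim {:g}).
Local Notation E := (vbasis {:g}).
Local Notation vec := 'rV[{mpoly F[N]}]_d.

(** Row vectors of polynomials are the elements of F[x] (x) g, so their
    coefficients are vectors of g. *)
Definition vcoef (v : vec) (m : 'X_{1..N}) : g := \sum_j (v 0 j)@_m *: E`_j.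

Lemma vcoefD v1 v2 m : vcoef (v1 + v2) m = vcoef v1 m + vcoef v2 m.
Proof. by rewrite -big_split; apply: eq_bigr => j _; rewrite mxE mcoeffD scalerDl. Qed.

Lemma vcoef0 m : vcoef 0 m = 0.
Proof. by rewrite /vcoef big1 // => j _; rewrite mxE mcoeff0 scale0r. Qed.

Lemma vcoefZ c v m : vcoef (c%:MP *: v) m = c *: vcoef v m.
Proof. by rewrite scaler_sumr; apply: eq_bigr => j _; rewrite mxE mcoeffCM scalerA. Qed.

Lemma vcoef_sum I r (P : pred I) (v : I -> vec) m :
  vcoef (\sum_(i <- r | P i) v i) m = \sum_(i <- r | P i) vcoef (v i) m.
Proof. by apply: (big_morph (vcoef^~ m)) => [u v'|]; rewrite ?vcoefD ?vcoef0. Qed.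

Lemma mcoeffXM i (p : {mpoly F[N]}) m :
  ('X_i * p)@_m = if (m i == 0)%N then 0 else p@_(m - U_(i))%MM.
Proof.
rewrite mulrC; have [mi|mi] := eqVneq (m i) 0%N.
  apply: memN_msupp_eq0; rewrite (perm_mem (msuppMX _ _)).
  by apply/mapP => -[k _ mk]; move: mi; rewrite mk mnmDE mnm1E eqxx.
have Um : (U_(i) <= m)%MM by rewrite lep1mP.
by rewrite -[in LHS](submK Um) addmC mcoeffMX.
Qed.

Lemma vcoefX i v m : vcoef ('X_i *: v) m =
  if (m i == 0)%N then 0 else vcoef v (m - U_(i))%MM.
Proof.
case: ifP => mi; last by apply: eq_bigr => j _; rewrite mxE mcoeffXM mi.
by rewrite /vcoef big1 // => j _; rewrite mxE mcoeffXM mi scale0r.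
Qed.

Lemma vcoef_ext_vec a m : vcoef (ext_vec N a) m = if m == 0%MM then a else 0.
Proof.
rewrite /vcoef; under eq_bigr => j _ do rewrite mxE mcoeffC.
case: eqP => _; last by rewrite big1 // => j _; rewrite mulr0 scale0r.
by rewrite [RHS](coord_vbasis (memvf a)); apply: eq_bigr => j _; rewrite mulr1.
Qed.

Lemma vcoef_ext_end v (phi : 'End(g)) m : vcoef (v *m ext_end N phi) m = phi (vcoef v m).
Proof.
rewrite linear_sum /vcoef.
under eq_bigr => j _ do rewrite mxE raddf_sum scaler_suml.
rewrite exchange_big; apply: eq_bigr => i _ /=.
rewrite linearZ /= [phi E`_i in RHS](coord_vbasis (memvf _)) scaler_sumr.
by apply: eq_bigr => j _; rewrite mxE mulrC mcoeffCM scalerA mulrC.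
Qed.

Lemma mcoeff_ext_form (phi : g -> F) v m :
  (forall c x y, phi (c *: x + y) = c * phi x + phi y) ->
  (ext_form phi v)@_m = phi (vcoef v m).
Proof.
move=> phiL; have phi0 : phi 0 = 0.
  have /eqP := phiL 1 0 0; rewrite scaler0 addr0 mul1r.
  by rewrite -[X in X == _]addr0 (inj_eq (addrI _)) eq_sym => /eqP.
rewrite raddf_sum /vcoef /=; elim/big_rec2: _ => // i p x _ ->.
by rewrite phiL mulrC mcoeffCM mulrC.
Qed.

Lemma vcoef_ad_u v m : vcoef (v *m ad_u f) m =
  \sum_i if (m i == 0)%N then 0 else lie f`_i (vcoef v (m - U_(i))%MM).
Proof.
rewrite mulmx_sumr vcoef_sum; apply: eq_bigr => i _.
by rewrite -scalemxAr vcoefX vcoef_ext_end adE (tnth_nth 0).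
Qed.

(* The sign [s] covers both ad(u(x)) and its opposite. *)
Section PowerSeries.
Variables (s : F) (c : nat -> F).
Local Notation M := (s%:MP *: ad_u f).

Lemma vcoef_ad_uZ v m : vcoef (v *m M) m =
  s *: \sum_i if (m i == 0)%N then 0 else lie f`_i (vcoef v (m - U_(i))%MM).
Proof. by rewrite -scalemxAr vcoefZ vcoef_ad_u. Qed.

Lemma vcoef_series v m :
  vcoef (v *m series_at c M) m = \sum_(k < d) c k *: vcoef (v *m M ^+ k) m.
Proof.
rewrite mulmx_sumr vcoef_sum; apply: eq_bigr => k _.
by rewrite -scalemxAr vcoefZ.
Qed.

(** ad(u(x)) raises the monomial by x_i while applying [lie f_i], so a family of
    subspaces compatible with these moves is stable under every power series. It is
    used for weight spaces and for nminus. *)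
Lemma series_stable (W : 'X_{1..N} -> {vspace g}) v :
  (forall (i : 'I_N) m x, x \in W m -> lie f`_i x \in W (m + U_(i))%MM) ->
  (forall m, vcoef v m \in W m) -> forall m, vcoef (v *m series_at c M) m \in W m.
Proof.
move=> WS vW m; rewrite vcoef_series memv_suml // => k _; apply: memvZ.
elim: {k}(val k) m => [|k IHk] m; first by rewrite mulmx1.
rewrite exprSr mulmxA vcoef_ad_uZ; apply/memvZ/memv_suml => i _.
case: eqP => [_|/eqP mi]; first exact: mem0v.
have Um : (U_(i) <= m)%MM by rewrite lep1mP.
by rewrite -[m in W m](submK Um); apply: WS.
Qed.

Lemma vcoef_pow_0 v k : vcoef (v *m M ^+ k.+1) 0%MM = 0.
Proof.
rewrite exprSr mulmxA vcoef_ad_uZ big1 ?scaler0 // => i _.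
by rewrite mnm0E eqxx.
Qed.

Lemma vcoef_pow_U v k j :
  vcoef (v *m M ^+ k.+1) U_(j)%MM = s *: lie f`_j (vcoef (v *m M ^+ k) 0%MM).
Proof.
rewrite exprSr mulmxA vcoef_ad_uZ (bigD1 j) //= mnm1E eqxx /= big1 => [|i ij].
  rewrite addr0; congr (_ *: lie _ (vcoef _ _)).
  by apply/mnmP => i; rewrite mnmBE subnn mnm0E.
by rewrite mnm1E (eq_sym j) (negbTE ij).
Qed.

Lemma vcoef_series_0 v : (0 < d)%N -> vcoef (v *m series_at c M) 0%MM = c 0%N *: vcoef v 0%MM.
Proof.
move=> d0; rewrite vcoef_series (bigD1 (Ordinal d0)) //= mulmx1 big1 ?addr0 // => -[[|k] kd] //= _.
by rewrite vcoef_pow_0 scaler0.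
Qed.

Lemma vcoef_series_U v j : (1 < d)%N -> vcoef (v *m series_at c M) U_(j)%MM =
  c 0%N *: vcoef v U_(j)%MM + c 1%N *: (s *: lie f`_j (vcoef v 0%MM)).
Proof.
move=> d1; rewrite vcoef_series (bigD1 (Ordinal (ltnW d1))) //= mulmx1; congr (_ + _).
rewrite (bigD1 (Ordinal d1)) //= vcoef_pow_U mulmx1 big1 ?addr0 // => -[[|[|k]] kd] //= _.
by rewrite vcoef_pow_U vcoef_pow_0 raddf0 !scaler0.
Qed.

End PowerSeries.

Lemma series_adE c : series_at c (ad_u f) = series_at c (1%:MP *: ad_u f).
Proof. by rewrite scale1r. Qed.

Lemma series_adNE c : series_at c (- ad_u f) = series_at c ((-1)%:MP *: ad_u f).
Proof. by rewrite mpolyCN mpolyC1 scaleN1r. Qed.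

End VectorCoefficients.

(** * Coefficients of the realization *)

Section RealizationCoefficients.
Variables (F : numFieldType) (g : lieAlgType F) (h : {vspace g}).
Hypothesis g_simple : simple_lie g.
Hypothesis h_cartan : cartan_subalgebra h.
Variables (N : nat) (alpha : 'I_N -> dual h) (f : N.-tuple g).
Hypothesis alpha_pos : positive_system alpha.
Hypothesis f_basis : root_basis alpha f.
Local Notation d := (\dim {:g}).

(** Up to sign, [pi_field a j] is the coefficient of d_j in the vector field of [a],
    and [pi_scalar] is the term of order 0. *)
Definition pi_field (a : g) (j : 'I_N) : {mpoly F[N]} :=
  ext_form (coord f j) (pi_vector alpha f a).

Definition pi_scalar (mu : dual h) (a : g) : {mpoly F[N]} :=
  ext_form (fun y => (mu + half_sum alpha) (vsproj h (proj_h alpha y)) : F) (exp_ad_u f a).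

Lemma dim_gt1 : (1 < d)%N.
Proof.
have [x [y xy]] := g_simple.1; rewrite ltnNge; apply: contra xy => d1.
have [->|x0] := eqVneq x 0; first by rewrite lie0l.
have /eqP yx : <[x]>%VS == fullv by rewrite eqEdim subvf dim_vline x0.
have : y \in <[x]>%VS by rewrite yx memvf.
by move=> /vlineP[c ->]; rewrite lieZr lie_alt scaler0.
Qed.

Lemma pi_fieldE a j m : (pi_field a j)@_m = coord f j (vcoef (pi_vector alpha f a) m).
Proof. by rewrite mcoeff_ext_form // => c x y; rewrite linearP. Qed.

Lemma pi_scalarE mu a m : (pi_scalar mu a)@_m =
  (mu + half_sum alpha) (vsproj h (proj_h alpha (vcoef (exp_ad_u f a) m))).
Proof. by rewrite mcoeff_ext_form // => c x y; rewrite !linearP. Qed.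

Lemma exp_ad_u_stable (W : 'X_{1..N} -> {vspace g}) a :
  (forall (i : 'I_N) m x, x \in W m -> lie f`_i x \in W (m + U_(i))%MM) ->
  a \in W 0%MM -> forall m, vcoef (exp_ad_u f a) m \in W m.
Proof.
move=> WS aW m; rewrite /exp_ad_u series_adNE; apply: series_stable m => // m.
by rewrite vcoef_ext_vec; case: eqP => [->|_] //; rewrite mem0v.
Qed.

Lemma vcoef_exp0 a : vcoef (exp_ad_u f a) 0%MM = a.
Proof.
rewrite /exp_ad_u series_adNE vcoef_series_0 ?(ltnW dim_gt1) // vcoef_ext_vec eqxx.
by rewrite /exp_coef invr1 scale1r.
Qed.

Lemma vcoef_expU a j : vcoef (exp_ad_u f a) U_(j)%MM = - lie f`_j a.
Proof.
rewrite /exp_ad_u series_adNE vcoef_series_U ?dim_gt1 // !vcoef_ext_vec eqxx.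
by rewrite mnm1_eq0 scaler0 add0r /exp_coef invr1 scale1r scaleN1r.
Qed.

Lemma pi_vector_nminus a m : vcoef (pi_vector alpha f a) m \in nminus alpha.
Proof.
rewrite /pi_vector series_adE; apply: (@series_stable _ _ _ _ _ _ (fun _ => nminus alpha)) => [i k x|k].
  by apply: (nminus_lie alpha_pos f_basis); apply: f_nminus.
by rewrite vcoef_ext_end memv_pi.
Qed.

Lemma pi_vector_weight (b : dual h) a m : a \in root_space b ->
  vcoef (pi_vector alpha f a) m \in root_space (b - xweight alpha m).
Proof.
move=> ab; have WS (i : 'I_N) k x : x \in root_space (b - xweight alpha k) ->
    lie f`_i x \in root_space (b - xweight alpha (k + U_(i))%MM).
  move=> xk; have := lie_root_space (f_weight f_basis i) xk.
  by rewrite xweightD xweightU opprD addrCA [- _ - _]addrC.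
rewrite /pi_vector series_adE.
apply: (@series_stable _ _ _ _ _ _ (fun m => root_space (b - xweight alpha m))) => // k.
rewrite vcoef_ext_end; apply: proj_nminus_weight => //.
apply: (@exp_ad_u_stable (fun m => root_space (b - xweight alpha m))) => //.
by rewrite xweight0 subr0.
Qed.

Lemma todd_coef0 : todd_coef F 0 = 1.
Proof. by have := todd_coefE F 0; rewrite big_ord1 divr1 invr1. Qed.

Lemma pi_field0 a j : (pi_field a j)@_0%MM = coord f j (proj_nminus alpha a).
Proof.
rewrite pi_fieldE /pi_vector series_adE vcoef_series_0 ?(ltnW dim_gt1) //.
by rewrite todd_coef0 scale1r vcoef_ext_end vcoef_exp0.
Qed.

(** The weights of the realization: if [a] has weight [b], the vector coefficient of
    x^m has weight [b - xweight m], and the [j]-th coordinate only sees the weight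
    [- alpha j]. *)
Lemma pi_field_weight (b : dual h) a j m : a \in root_space b ->
  (pi_field a j)@_m != 0 -> xweight alpha m = b + alpha j.
Proof.
move=> ab; rewrite pi_fieldE => cN.
have := coord_f_weight f_basis (pi_vector_nminus a m) (pi_vector_weight m ab) cN.
by move=> /(congr1 -%R); rewrite opprK opprB => ->; rewrite addrC subrK.
Qed.

Lemma coord_f_f (i j : 'I_N) : coord f j f`_i = (i == j)%:R.
Proof. by rewrite coord_free ?(basis_free f_basis.1). Qed.

Lemma pi_field_f0 (i : 'I_N) j : (pi_field f`_i j)@_0%MM = (i == j)%:R.
Proof. by rewrite pi_field0 proj_nminus_id ?coord_f_f // (f_nminus f_basis). Qed.

Lemma pi_field_cartanU t j k : t \in h ->
  (pi_field t j)@_U_(k)%MM = - (alpha j (vsproj h t) : F) *+ (k == j).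
Proof.
move=> th; rewrite pi_fieldE /pi_vector series_adE vcoef_series_U ?dim_gt1 //.
rewrite todd_coef0 !vcoef_ext_end vcoef_exp0 vcoef_expU [proj_nminus alpha t]proj_nminus_cartan //.
rewrite (raddf0 (lie _)) !scaler0 addr0 scale1r (f_lie_cartan f_basis) // -scaleNr linearZ /=.
rewrite proj_nminus_id ?(f_nminus f_basis) // linearZ /= coord_f_f.
by case: eqP => [->|_]; rewrite ?mulr1 ?mulr0.
Qed.

Lemma pi_scalar_nminus mu y : y \in nminus alpha -> pi_scalar mu y = 0.
Proof.
move=> yn; apply/mpolyP => m; rewrite pi_scalarE mcoeff0 proj_h_nminus ?linear0 //.
apply: (@exp_ad_u_stable (fun _ => nminus alpha)) => // i k x.
by apply: (nminus_lie alpha_pos f_basis); apply: f_nminus.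
Qed.

Lemma pi_scalar_nplus mu z : z \in nplus alpha -> (pi_scalar mu z)@_0%MM = 0.
Proof. by move=> zn; rewrite pi_scalarE vcoef_exp0 proj_h_nplus ?linear0. Qed.

Lemma pi_scalar_cartan mu t : t \in h ->
  pi_scalar mu t = ((mu + half_sum alpha) (vsproj h t) : F)%:MP.
Proof.
move=> th; apply/mpolyP => m; rewrite pi_scalarE mcoeffC.
have [->|m0] := eqVneq m 0%MM; first by rewrite vcoef_exp0 proj_h_id // mulr1.
rewrite mulr0 proj_h_nminus ?linear0 //.
have := @exp_ad_u_stable (fun m => if m == 0%MM then h else nminus alpha) t _ _ m.
rewrite (negbTE m0); apply; last by rewrite eqxx.
move=> i k x; rewrite mnmD_eq0 mnm1_eq0 andbF; case: eqP => _.
  by move=> xh; rewrite (f_lie_cartan f_basis) // memvZ // (f_nminus f_basis).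
by apply: (nminus_lie alpha_pos f_basis); apply: f_nminus.
Qed.

End RealizationCoefficients.

(** * The right action of the Weyl algebra on polynomials *)

Section PresentedSpan.
Variables (F : fieldType) (P : presentation F).

Lemma presented_span (Q : presented_alg P -> Prop) :
  Q 0 -> (forall u v, Q u -> Q v -> Q (u + v)) -> (forall c v, Q v -> Q (c *: v)) ->
  (forall s : seq (gens P), Q (\prod_(x <- s) presented_gen x)) -> forall v, Q v.
Proof.
move=> Q0 QD QZ Qw v; have [a ->] := presented_pi_surj v.
have wordE (k : fmonom (gens P)) c :
    presented_pi (mkmalgU k c) = c *: \prod_(x <- (k : seq _)) presented_gen x.
  have -> : mkmalgU k c = c *: mkmalgU k 1 :> free_alg F (gens P).
    by apply/malgP => l; rewrite monalg.mcoeffZ !monalg.mcoeffU mulrnAr mulr1.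
  rewrite presented_piZ; congr (_ *: _); case: k => s.
  elim: s => [|x s IHs] /=.
    rewrite big_nil -[RHS]/(presented_pi 1); congr presented_pi.
    by rewrite -monalg.fmoneE.
  rewrite big_cons -IHs -presented_piM; congr presented_pi.
  rewrite malgM_def monalg.fgmulUU mulr1; congr (mkmalgU _ _).
  by apply/val_inj; rewrite /= fmM fmU.
rewrite (monalg.monalgE a) (big_morph _ (@presented_piD _ _) (@presented_pi0 _ _)).
elim/big_rec: _ => [|k u _ Qu]; first exact: Q0.
by apply: QD => //; rewrite wordE; apply/QZ/Qw.
Qed.

End PresentedSpan.

Section WeylRightAction.
Variables (F : fieldType) (N : nat).
Local Notation A := (weyl F N).
Local Notation poly := {mpoly F[N]}.

Definition letter_act (p : poly) (l : 'I_N + 'I_N) : poly :=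
  match l with inl i => 'X_i * p | inr i => - p^`M(i) end.

Definition free_act (p : poly) (w : free_alg F ('I_N + 'I_N)%type) : poly :=
  monalg.mmap (@mpolyC N F) (fun k : fmonom _ => foldl letter_act p k) w.

Lemma word_actD s : {morph foldl letter_act ^~ s : p q / p + q}.
Proof.
elim: s => //= -[i|i] s IHs p q; rewrite -IHs /=; congr foldl; first exact: mulrDr.
by rewrite mderivD opprD.
Qed.

Lemma word_actZ s c : {morph foldl letter_act ^~ s : p / c%:MP * p}.
Proof.
elim: s => //= -[i|i] s IHs p; rewrite -IHs /=; congr foldl; first by rewrite mulrCA.
by rewrite mderiv_mulC mulrN.
Qed.

Lemma word_act0 s : foldl letter_act 0 s = 0.
Proof. by have := word_actZ s 0 0; rewrite mpolyC0 !mul0r. Qed.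

Lemma free_act0 p : free_act p 0 = 0.
Proof. exact: raddf0. Qed.

Lemma free_actD p u v : free_act p (u + v) = free_act p u + free_act p v.
Proof. exact: raddfD. Qed.

Lemma free_actB p u v : free_act p (u - v) = free_act p u - free_act p v.
Proof. exact: raddfB. Qed.

Lemma free_actU p c k : free_act p (mkmalgU k c) = c%:MP * foldl letter_act p k.
Proof. exact: monalg.mmapU. Qed.

Lemma free_actDl p q u : free_act (p + q) u = free_act p u + free_act q u.
Proof. by rewrite -big_split; apply: eq_bigr => k _; rewrite word_actD mulrDr. Qed.

Lemma free_act0l u : free_act 0 u = 0.
Proof. by rewrite /free_act /monalg.mmap big1 // => k _; rewrite word_act0 mulr0. Qed.

Lemma free_actZl c p u : free_act (c%:MP * p) u = c%:MP * free_act p u.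
Proof. by rewrite mulr_sumr; apply: eq_bigr => k _; rewrite word_actZ mulrCA. Qed.

Lemma free_actM p u v : free_act p (u * v) = free_act (free_act p u) v.
Proof.
rewrite malgME (big_morph (free_act p) (free_actD p) (free_act0 p)).
rewrite [X in free_act X v]/free_act /monalg.mmap.
rewrite (big_morph (free_act^~ v) (fun p q => free_actDl p q v) (free_act0l v)).
apply: eq_bigr => k _; rewrite (big_morph (free_act p) (free_actD p) (free_act0 p)) /=.
rewrite free_actZl [X in _ = _ * X]/free_act /monalg.mmap mulr_sumr.
by apply: eq_bigr => l _; rewrite free_actU fmM foldl_cat mpolyCM -mulrA.
Qed.

Lemma free_actZ p c u : free_act p (c *: u) = c%:MP * free_act p u.
Proof. by rewrite -mul_malgC free_actM free_actU fm1 free_actZl. Qed.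

Lemma free_act_gen p l : free_act p (free_gen F l) = letter_act p l.
Proof. by rewrite /free_gen free_actU fmU mul1r. Qed.

Lemma free_act_gen2 p k l :
  free_act p (free_gen F k * free_gen F l) = letter_act (letter_act p k) l.
Proof. by rewrite (free_actM p (free_gen F k)) 2!free_act_gen. Qed.

Lemma free_act1 p : free_act p 1 = p.
Proof. by rewrite free_actU mul1r fm1. Qed.

Lemma free_act_rel p w : two_sided_ideal (@weyl_rel F N) w -> free_act p w = 0.
Proof.
move=> Iw; elim: Iw p => [a s b srel|| a b _ a0 _ b0] p; last 2 first.
- exact: free_act0.
- by rewrite free_actB a0 b0 subr0.
suff act_s q : free_act q s = 0 by rewrite !free_actM act_s free_act0l.
case: {a b} srel => i j.
- apply: etrans (free_actB q _ _) _.
  apply: etrans (congr2 (fun u v => u - v) (free_act_gen2 q _ _) (free_act_gen2 q _ _)) _.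
  by rewrite /= mulrCA subrr.
- apply: etrans (free_actB q _ _) _.
  apply: etrans (congr2 (fun u v => u - v) (free_act_gen2 q _ _) (free_act_gen2 q _ _)) _.
  by rewrite /= !mderivN !opprK mderiv_comm subrr.
- have actN : free_act q (i == j)%:R = (i == j)%:R * q.
    by case: eqP => _; rewrite ?free_act1 ?mul1r // mul0r free_act0.
  apply: etrans (free_actB q _ _) _.
  apply: etrans (congr2 (fun u v => u - v) (free_actB q _ _) actN) _.
  apply: etrans (congr2 (fun u v => u - v - (i == j)%:R * q)
    (free_act_gen2 q _ _) (free_act_gen2 q _ _)) _ => /=.
  rewrite mderivM mderivX mnm1E eq_sym mulrN opprK [- _ + _]addrC addrK.
  case: eqP => [->|_]; last by rewrite scale0r mul0r subrr.
  have -> : (U_(j) - U_(j) = 0 :> 'X_{1..N})%MM.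
    by apply/mnmP => k; rewrite mnmBE subnn mnm0E.
  by rewrite scale1r mpolyX0 subrr.
Qed.

(** The right action obtained by transposing the differential operators: [d_i] acts
    as [- d/dx_i]. Being transposed, it turns the realization into (the dual of) a
    highest weight module for the given Borel subalgebra, which the usual left
    action does not. *)
Definition ract (p : poly) (w : A) : poly := free_act p (repr w).

Lemma ract_pi p a : ract p (presented_pi a : A) = free_act p a.
Proof.
apply/eqP; rewrite -subr_eq0 -free_actB; apply/eqP/free_act_rel.
by apply/(@presented_piE _ (Presentation (@weyl_rel_proper F N))); rewrite {1}/presented_pi reprK.
Qed.

Lemma ractD p u v : ract p (u + v) = ract p u + ract p v.
Proof.
have [a ->] := presented_pi_surj u; have [b ->] := presented_pi_surj v.
by rewrite -presented_piD !ract_pi free_actD.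
Qed.

Lemma ractM p u v : ract p (u * v) = ract (ract p u) v.
Proof.
have [a ->] := presented_pi_surj u; have [b ->] := presented_pi_surj v.
by rewrite -presented_piM !ract_pi free_actM.
Qed.

Lemma ractZ p c u : ract p (c *: u) = c *: ract p u.
Proof.
have [a ->] := presented_pi_surj u.
by rewrite -presented_piZ !ract_pi free_actZ mul_mpolyC.
Qed.

Lemma ractDl p q u : ract (p + q) u = ract p u + ract q u.
Proof. exact: free_actDl. Qed.

Lemma ractZl c p u : ract (c *: p) u = c *: ract p u.
Proof. by rewrite -!mul_mpolyC; apply: free_actZl. Qed.

Lemma ract_x p i : ract p (weyl_x F i) = 'X_i * p.
Proof. by rewrite /weyl_x /presented_gen ract_pi free_act_gen. Qed.

Lemma ract_d p i : ract p (weyl_d F i) = - p^`M(i).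
Proof. by rewrite /weyl_d /presented_gen ract_pi free_act_gen. Qed.

Lemma ract1 p : ract p 1 = p.
Proof. by rewrite -[1]/(presented_pi 1 : A) ract_pi free_act1. Qed.

Lemma ract0 p : ract p 0 = 0.
Proof. by rewrite -[0](scale0r 1) ractZ scale0r. Qed.

Lemma ractN p u : ract p (- u) = - ract p u.
Proof. by rewrite -scaleN1r ractZ scaleN1r. Qed.

Lemma ract0l u : ract 0 u = 0.
Proof. by rewrite -[0 in LHS](scale0r 0) ractZl scale0r. Qed.

Lemma ract_sum p I r (P : pred I) (u : I -> A) :
  ract p (\sum_(i <- r | P i) u i) = \sum_(i <- r | P i) ract p (u i).
Proof. exact: (big_morph _ (ractD p) (ract0 p)). Qed.

End WeylRightAction.

(** * Faithfulness of the right action *)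

Section Monomials.
Variable (N : nat).

Lemma mmap1_commU (S : nzRingType) (u : 'I_N -> S) m i :
  (forall i j, u i * u j = u j * u i) -> mmap1 u (m + U_(i))%MM = mmap1 u m * u i.
Proof.
move=> uC; rewrite -[u i in RHS](mmap1U u i) -prodrM_comm => [|j k _ _].
  by apply: eq_bigr => j _; rewrite mnmDE exprD.
by apply/commrX/commr_sym/commrX.
Qed.

Lemma mnm_neq0 (m : 'X_{1..N}) : m != 0%MM -> exists i k, m = (k + U_(i))%MM.
Proof.
move=> m0; have [i mi] : exists i, m i != 0%N.
  apply/existsP; apply: contraNT m0 => /existsPn m0; apply/eqP/mnmP => i.
  by rewrite mnm0E; apply/eqP; rewrite -[_ == _]negbK.
by exists i, (m - U_(i))%MM; rewrite submK // lep1mP.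
Qed.

Lemma mnm_ind (P : 'X_{1..N} -> Prop) :
  P 0%MM -> (forall m i, P m -> P (m + U_(i))%MM) -> forall m, P m.
Proof.
move=> P0 PU m; have [k] := ubnP (mdeg m); elim: k m => // k IHk m mk.
have [->|/mnm_neq0[i [l mE]]] := eqVneq m 0%MM; first exact: P0.
by move: mk; rewrite mE mdegD mdeg1 addn1 ltnS => /IHk/PU.
Qed.

End Monomials.

(** Faithfulness only depends on the commutation relations, on the span of the words
    and on the formulas for the action, whatever the construction of the algebra. *)
Section CanonicalCommutation.
Variables (F : fieldType) (N : nat) (S : algType F) (x D : 'I_N -> S).
Hypothesis xx : forall i j, x i * x j = x j * x i.
Hypothesis dd : forall i j, D i * D j = D j * D i.
Hypothesis xd : forall i j, x j * D i = D i * x j - (i == j)%:R.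
Local Notation poly := {mpoly F[N]}.
Local Notation wp := (mmap (GRing.in_alg S) x).

Lemma in_alg_mmapZ c (p : poly) : wp (c *: p) = c *: wp p.
Proof. by rewrite mmapZ mulr_algl. Qed.

Lemma mmap_commMX (q : poly) j : wp (q * 'X_j) = wp q * x j.
Proof.
elim/mpolyind: q => [|c m q _ _ IHq]; first by rewrite mul0r mmap0 mul0r.
rewrite mulrDl !mmapD mulrDl IHq; congr (_ + _).
rewrite -scalerAl !in_alg_mmapZ -scalerAl -mpolyXD !mmapX; congr (_ *: _).
exact: mmap1_commU.
Qed.

Lemma mmap_comm_d (q : poly) i : wp q * D i = D i * wp q - wp q^`M(i).
Proof.
elim/mpolyind: q => [|c m q _ _ IHq].
  by rewrite mderiv0 mmap0 mul0r mulr0 subr0.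
rewrite mderivD !mmapD mulrDl IHq mulrDr opprD addrACA; congr (_ + _).
rewrite mderivZ !in_alg_mmapZ -scalerAl -scalerAr -scalerBr; congr (_ *: _).
elim/mnm_ind: m => [|m j IHm].
  by rewrite mmapX mderivX mnm0E scale0r mmap0 mmap11 mul1r mulr1 subr0.
rewrite mpolyXD mderivM mmapD !mmap_commMX -mulrA xd.
rewrite mulrBr mulrA IHm mulrBl opprD addrA -mulrA; congr (_ - _ - _).
rewrite mderivX mnm1E (eq_sym j i); case: eqP => [->|_]; last by rewrite scale0r !mulr0 mmap0.
rewrite scale1r mulr1.
have -> : (U_(j) - U_(j) = 0 :> 'X_{1..N})%MM by apply/mnmP => k; rewrite mnmBE subnn mnm0E.
by rewrite mpolyX0 mulr1.
Qed.


Variable act : poly -> S -> poly.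
Hypothesis actD : forall p u v, act p (u + v) = act p u + act p v.
Hypothesis actM : forall p u v, act p (u * v) = act (act p u) v.
Hypothesis actZ : forall p c u, act p (c *: u) = c *: act p u.
Hypothesis actZl : forall c p u, act (c *: p) u = c *: act p u.
Hypothesis act1 : forall p, act p 1 = p.
Hypothesis act_x : forall p i, act p (x i) = 'X_i * p.
Hypothesis act_d : forall p i, act p (D i) = - p^`M(i).

Lemma act0 p : act p 0 = 0.
Proof. by rewrite -[0](scale0r 1) actZ scale0r. Qed.

Lemma act0l u : act 0 u = 0.
Proof. by rewrite -[0 in LHS](scale0r 0) actZl scale0r. Qed.

Lemma act_sum p I r (P : pred I) (u : I -> S) :
  act p (\sum_(i <- r | P i) u i) = \sum_(i <- r | P i) act p (u i).
Proof. exact: (big_morph _ (actD p) (act0 p)). Qed.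

Lemma act_poly (p q : poly) : act p (wp q) = q * p.
Proof.
elim/mpolyind: q => [|c m q _ _ IHq]; first by rewrite mmap0 act0 mul0r.
rewrite mmapD actD IHq mulrDl; congr (_ + _).
rewrite in_alg_mmapZ actZ -scalerAl; congr (_ *: _).
elim/mnm_ind: m => [|m j IHm]; first by rewrite mmapX mmap11 act1 mpolyX0 mul1r.
by rewrite mpolyXD mmap_commMX actM IHm act_x mulrCA mulrA.
Qed.

Local Notation Dm := (mmap1 D).

Lemma act_Dm (p : poly) b : act p (Dm b) = (-1) ^+ mdeg b *: p^`M[b].
Proof.
elim/mnm_ind: b => [|b i IHb]; first by rewrite mmap11 act1 mdeg0 scale1r mderivm0m.
rewrite (mmap1_commU _ _ dd) actM IHb actZl act_d mderivmDm mderivmU1m.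
by rewrite mdegD mdeg1 addn1 exprS mulN1r scaleNr scalerN.
Qed.

Hypothesis S_span : forall Q : S -> Prop,
  Q 0 -> (forall u v, Q u -> Q v -> Q (u + v)) -> (forall c v, Q v -> Q (c *: v)) ->
  (forall s : seq ('I_N + 'I_N),
     Q (\prod_(l <- s) match l with inl i => x i | inr i => D i end)) -> forall v, Q v.

(** Derivations can be moved to the left of the polynomials. *)
Lemma normal_form (w : S) : exists s : seq ('X_{1..N} * poly),
  w = \sum_(u <- s) Dm u.1 * wp u.2.
Proof.
pose NF w := exists s : seq ('X_{1..N} * poly), w = \sum_(u <- s) Dm u.1 * wp u.2.
apply: (S_span (Q := NF)) => [|_ _ [s ->] [t ->]|c _ [s ->]|s].
- by exists [::]; rewrite big_nil.
- by exists (s ++ t); rewrite big_cat.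
- exists [seq (u.1, c *: u.2) | u <- s]; rewrite big_map scaler_sumr.
  by apply: eq_bigr => u _; rewrite in_alg_mmapZ scalerAr.
elim/last_ind: s => [|s l [t tE]].
  exists [:: (0%MM, 'X_[0])]; rewrite big_nil big_seq1 mmap11 mmapX mmap11.
  by rewrite mul1r.
rewrite big_rcons /= tE; case: l => i.
  exists [seq (u.1, u.2 * 'X_i) | u <- t]; rewrite big_map mulr_suml.
  by apply: eq_bigr => u _; rewrite mmap_commMX mulrA.
exists ([seq ((u.1 + U_(i))%MM, u.2) | u <- t] ++ [seq (u.1, - u.2^`M(i)) | u <- t]).
rewrite big_cat /= !big_map mulr_suml -big_split; apply: eq_bigr => u _ /=.
by rewrite -mulrA mmap_comm_d mulrBr mulrA mmapN mulrN (mmap1_commU _ _ dd).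
Qed.

(** Write the element as the sum of [Dm b * wp (Q b)]. Applied to the monomial x^b,
    the term of [b] gives a nonzero multiple of [Q b], and the other terms vanish
    unless their exponent strictly divides [b]; so [Q b = 0] by induction on the
    degree of [b]. *)
Lemma act_faithful (w : S) : (forall n, n.+1%:R != 0 :> F) ->
  (forall p, act p w = 0) -> w = 0.
Proof.
move=> char0 w0; have [s wE] := normal_form w.
pose bs := undup [seq u.1 | u <- s].
pose Q b : poly := \sum_(u <- s | u.1 == b) u.2.
have {}wE : w = \sum_(b <- bs) Dm b * wp (Q b).
  rewrite wE; transitivity (\sum_(b <- bs) \sum_(u <- s | u.1 == b) Dm u.1 * wp u.2).
    rewrite (exchange_big_dep predT) //= big_seq [RHS]big_seq; apply: eq_bigr => u us.
    rewrite big_mkcond (bigD1_seq u.1) ?undup_uniq ?mem_undup ?map_f //= eqxx.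
    by rewrite big1 ?addr0 // => b bu; rewrite eq_sym (negbTE bu).
  apply: eq_bigr => b _; rewrite /Q raddf_sum mulr_sumr.
  by apply: eq_bigr => u /eqP ->.
suff Q0 b : b \in bs -> Q b = 0.
  by rewrite wE big_seq big1 // => b /Q0 ->; rewrite mmap0 mulr0.
have [k] := ubnP (mdeg b); elim: k b => // k IHk b bk bb.
have := w0 'X_[b]; rewrite wE act_sum (bigD1_seq b) ?undup_uniq //= big_seq_cond big1 => [|c].
  rewrite addr0 actM act_Dm mderivmX act_poly => /eqP.
  have -> : (b - b = 0)%MM by apply/mnmP => i; rewrite mnmBE subnn mnm0E.
  rewrite mpolyX0 scalerA -scalerAr mulr1 scaler_eq0 mulf_eq0 expf_eq0 oppr_eq0 oner_eq0 andbF /=.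
  case/orP => [|/eqP //]; have : (0 < \prod_(i < N) b i ^_ (b i))%N.
    by rewrite prodn_gt0 // => i; rewrite ffactnn fact_gt0.
  by case: (\prod_(i < N) _)%N => // n _; rewrite (negbTE (char0 n)).
case/andP => cbs cb; rewrite actM act_Dm mderivmX.
have [le_cb|] := boolP (c <= b)%MM.
  rewrite (IHk c _ cbs) ?mmap0 ?act0 // -ltnS; apply: leq_trans bk.
  rewrite -(submK le_cb) mdegD !ltnS -[X in (X < _)%N]add0n ltn_add2r lt0n mdeg_eq0.
  by apply: contra cb => /eqP bc; rewrite -(submK le_cb) bc add0m.
move=> ncb; have [i bi] : exists i, (b i < c i)%N.
  apply/existsP; apply: contraNT ncb => /existsPn bc; apply/mnm_lepP => i.
  by rewrite leqNgt bc.
by rewrite (bigD1 i) //= ffact_small // mul0n scale0r scaler0 act0l.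
Qed.

End CanonicalCommutation.

Section WeylNormalForm.
Variables (F : fieldType) (N : nat).
Local Notation A := (weyl F N).
Local Notation poly := {mpoly F[N]}.
Local Notation x := (@weyl_x F N).
Local Notation D := (@weyl_d F N).

Lemma presented_piB (P : presentation F) : {morph @presented_pi F P : a b / a - b}.
Proof.
by move=> a b; apply: (addIr (presented_pi b)); rewrite -presented_piD !subrK.
Qed.

Lemma presented_rel0 (P : presentation F) r : rels r -> presented_pi r = 0 :> presented_alg P.
Proof.
move=> Pr; rewrite -presented_pi0; apply/presented_piE; rewrite subr0.
by rewrite -[r]mul1r -[_ * r]mulr1; apply: TI_mul.
Qed.

Lemma weyl_xx i j : x i * x j = x j * x i :> A.
Proof.
apply/eqP; rewrite -subr_eq0; apply/eqP.
rewrite -!presented_piM -presented_piB.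
exact: (@presented_rel0 (Presentation (@weyl_rel_proper F N)) _ (WR_xx F i j)).
Qed.

Lemma weyl_dd i j : D i * D j = D j * D i :> A.
Proof.
apply/eqP; rewrite -subr_eq0; apply/eqP.
rewrite -!presented_piM -presented_piB.
exact: (@presented_rel0 (Presentation (@weyl_rel_proper F N)) _ (WR_dd F i j)).
Qed.

Lemma weyl_xd i j : x j * D i = D i * x j - (i == j)%:R :> A.
Proof.
apply/eqP; rewrite eq_sym subr_eq addrC -subr_eq -subr_eq0; apply/eqP.
have -> : (i == j)%:R = presented_pi (i == j)%:R :> A.
  by case: eqP => _; rewrite ?presented_pi0.
rewrite -!presented_piM -!presented_piB.
exact: (@presented_rel0 (Presentation (@weyl_rel_proper F N)) _ (WR_dx F i j)).
Qed.

Lemma ract_poly p (q : poly) : ract p (weyl_poly q) = q * p.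
Proof.
exact: (act_poly weyl_xx (@ractD F N) (@ractM F N) (@ractZ F N) (@ract1 F N) (@ract_x F N)).
Qed.

Lemma ract_faithful (w : A) : (forall n, n.+1%:R != 0 :> F) ->
  (forall p, ract p w = 0) -> w = 0.
Proof.
apply: (act_faithful weyl_xx weyl_dd weyl_xd (@ractD F N) (@ractM F N) (@ractZ F N)
  (@ractZl F N) (@ract1 F N) (@ract_x F N) (@ract_d F N)).
move=> Q Q0 QD QZ Qw; apply: presented_span => // s.
have -> : \prod_(l <- s) presented_gen l =
    \prod_(l <- s) match l with inl i => x i | inr i => D i end :> A.
  by apply: eq_bigr => -[].
exact: Qw.
Qed.

End WeylNormalForm.

(** * The Harish-Chandra projection *)

Section Triangular.
Variables (F : fieldType) (g : lieAlgType F) (U : algType F) (iota : g -> U).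
Hypothesis iotaL : forall c x y, iota (c *: x + y) = c *: iota x + iota y.
Hypothesis iota_lie : forall x y, iota x * iota y - iota y * iota x = iota (lie x y).
Hypothesis U_span : forall Q : U -> Prop,
  Q 0 -> (forall u v, Q u -> Q v -> Q (u + v)) -> (forall c v, Q v -> Q (c *: v)) ->
  (forall s : seq g, Q (\prod_(x <- s) iota x)) -> forall v, Q v.
Variables (nbar h npos : {vspace g}).
Hypothesis decomposition : forall x, exists y t z,
  [/\ y \in nbar, t \in h, z \in npos & x = y + t + z].
Hypothesis h_abelian : forall s t, s \in h -> t \in h -> lie s t = 0.
Hypothesis npos_h : forall t z, t \in h -> z \in npos -> lie t z \in npos.
Local Notation hbasis i := ((vbasis h)`_(nat_of_ord i)).
Local Notation Uh := (mmap (GRing.in_alg U) (fun i : 'I_(\dim h) => iota (hbasis i))).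

Lemma iota0 : iota 0 = 0.
Proof. by have := iotaL (-1) 0 0; rewrite scaler0 addr0 scaleN1r addNr. Qed.

Lemma iotaD x y : iota (x + y) = iota x + iota y.
Proof. by rewrite -[x in LHS]scale1r iotaL scale1r. Qed.

Lemma iotaM x y : iota x * iota y = iota y * iota x + iota (lie x y).
Proof. by rewrite -iota_lie addrC subrK. Qed.

Lemma hbasis_h (i : 'I_(\dim h)) : hbasis i \in h.
Proof. by rewrite vbasis_mem // mem_nth ?size_tuple. Qed.

Lemma iota_hh (i j : 'I_(\dim h)) : iota (hbasis i) * iota (hbasis j) = iota (hbasis j) * iota (hbasis i).
Proof. by rewrite iotaM h_abelian ?hbasis_h // iota0 addr0. Qed.

(** The left ideal of [U] generated by [npos]. *)
Inductive right_npos : U -> Prop :=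
| RN_mul u x : x \in npos -> right_npos (u * iota x)
| RN_zero : right_npos 0
| RN_add u v : right_npos u -> right_npos v -> right_npos (u + v).

Lemma right_nposZ c u : right_npos u -> right_npos (c *: u).
Proof.
elim=> [v x xn||v w _ IHv _ IHw]; rewrite ?scaler0 ?scalerDr ?scalerAl.
- exact: RN_mul.
- exact: RN_zero.
- exact: RN_add.
Qed.

Lemma right_nposM_h u (i : 'I_(\dim h)) : right_npos u -> right_npos (u * iota (hbasis i)).
Proof.
elim=> [v x xn||v w _ IHv _ IHw]; rewrite ?mul0r ?mulrDl; last 2 first.
- exact: RN_zero.
- exact: RN_add.
rewrite -mulrA iotaM mulrDr mulrA; apply: RN_add; apply: RN_mul => //.
by rewrite lie_anti memvN npos_h ?hbasis_h.
Qed.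

Lemma right_nposM_Uh u q : right_npos u -> right_npos (u * Uh q).
Proof.
move=> nu; elim/mpolyind: q => [|c m q _ _ IHq]; first by rewrite mmap0 mulr0; apply: RN_zero.
rewrite mmapD mulrDr; apply: RN_add => //.
rewrite in_alg_mmapZ -scalerAr; apply: right_nposZ.
elim/mnm_ind: m => [|m j IHm]; first by rewrite mmapX mmap11 mulr1.
by rewrite mpolyXD (mmap_commMX iota_hh) mulrA; apply: right_nposM_h.
Qed.

Lemma iota_hbasis_Uh (i : 'I_(\dim h)) q : iota (hbasis i) * Uh q = Uh (q * 'X_i).
Proof.
rewrite (mmap_commMX iota_hh) /mmap mulr_sumr mulr_suml; apply: eq_bigr => m _.
rewrite /= -!scalerAl !mul1r -scalerAr; congr (_ *: _).
apply: commr_prod => j _; apply: commrX; exact: iota_hh.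
Qed.

(** U(nbar) U(h) + U npos, generated in a way that makes its stability under left
    multiplication by [g] an induction. *)
Inductive triangular : U -> Prop :=
| Tri_h q : triangular (Uh q)
| Tri_npos u : right_npos u -> triangular u
| Tri_add u v : triangular u -> triangular v -> triangular (u + v)
| Tri_nbar y u : y \in nbar -> triangular u -> triangular (iota y * u).

Lemma triangularZ c u : triangular u -> triangular (c *: u).
Proof.
elim=> [q|v nv|v w _ IHv _ IHw|y v yn _ IHv].
- by rewrite -in_alg_mmapZ; apply: Tri_h.
- by apply/Tri_npos/right_nposZ.
- by rewrite scalerDr; apply: Tri_add.
- by rewrite scalerAr; apply: Tri_nbar.
Qed.

(** Commuting [a] past an element of [nbar] adds the product of their bracket with a
    shorter element, to which the induction hypothesis applies whatever the position
    of the bracket in [g]; only in front of U(h) is [a] decomposed. *)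
Lemma triangularM u a : triangular u -> triangular (iota a * u).
Proof.
move=> Tu; elim: Tu a => [q|v nv|v w _ IHv _ IHw|y v yn _ IHv] a.
- have [y [t [z [yn th zn ->]]]] := decomposition a.
  rewrite !iotaD !mulrDl; apply: Tri_add; first apply: Tri_add.
  + exact/Tri_nbar/Tri_h.
  + rewrite (coord_vbasis th); elim/big_rec: _ => [|i s _ Ts].
      by rewrite iota0 mul0r -[0](@mmap0 _ _ _ (fun i : 'I_(\dim h) => iota (hbasis i)) (GRing.in_alg U)); apply: Tri_h.
    rewrite iotaL mulrDl; apply: Tri_add => //.
    by rewrite -scalerAl iota_hbasis_Uh; apply/triangularZ/Tri_h.
  + apply/Tri_npos/right_nposM_Uh; rewrite -[iota z]mul1r; exact: RN_mul.
- apply: Tri_npos; elim: nv => [v1 x xn||v1 v2 _ IH1 _ IH2]; rewrite ?mulrA ?mulr0 ?mulrDr.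
  + exact: RN_mul.
  + exact: RN_zero.
  + exact: RN_add.
- by rewrite mulrDr; apply: Tri_add.
- rewrite mulrA iotaM mulrDl -mulrA; apply: Tri_add => //.
  exact: Tri_nbar.
Qed.

Lemma triangular_all u : triangular u.
Proof.
apply: U_span u => [|u v Tu Tv|c v Tv|s].
- exact/Tri_npos/RN_zero.
- exact: Tri_add.
- exact: triangularZ.
elim: s => [|x s IHs]; last by rewrite big_cons; apply: triangularM.
by rewrite big_nil -(mmap11 (fun i : 'I_(\dim h) => iota (hbasis i))) -(mmapX _ (GRing.in_alg U)); apply: Tri_h.
Qed.

Lemma triangular_projection (C : U -> Prop) :
  (forall y u, y \in nbar -> C (iota y * u)) -> (forall u x, x \in npos -> C (u * iota x)) ->
  C 0 -> (forall u v, C u -> C v -> C (u + v)) -> forall u, exists q, C (u - Uh q).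
Proof.
move=> Cn Cp C0 CD u; elim: (triangular_all u) => [q|v nv|v w _ [q Cq] _ [r Cr]|y v yn _ _].
- by exists q; rewrite subrr.
- exists 0; rewrite mmap0 subr0.
  by elim: nv => [v1 x xn||v1 v2 _ C1 _ C2]; [apply: Cp | | apply: CD].
- by exists (q + r); rewrite mmapD opprD addrACA; apply: CD.
- by exists 0; rewrite mmap0 subr0; apply: Cn.
Qed.

End Triangular.

Section EnvelopingProjection.
Variables (F : numFieldType) (g : lieAlgType F) (h : {vspace g}).
Hypothesis h_cartan : cartan_subalgebra h.
Variables (N : nat) (alpha : 'I_N -> dual h).
Hypothesis alpha_pos : positive_system alpha.

Lemma env_injL c (x y : g) : env_inj (c *: x + y) = c *: env_inj x + env_inj y.
Proof.
have := @presented_rel0 _ (Presentation (@env_rel_proper F g)) _ (ER_linear c x y).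
by rewrite presented_piB presented_piD presented_piZ => /eqP; rewrite subr_eq0 => /eqP.
Qed.

Lemma env_inj_lie (x y : g) : env_inj x * env_inj y - env_inj y * env_inj x = env_inj (lie x y).
Proof.
apply/eqP; rewrite -subr_eq0; apply/eqP; rewrite -!presented_piM -!presented_piB.
exact: (@presented_rel0 _ (Presentation (@env_rel_proper F g)) _ (ER_lie x y)).
Qed.

Lemma hc_projP (z : enveloping g) : hc_complement alpha (z - Uh_inj (hc_proj alpha z)).
Proof.
have [abel _ _] := h_cartan.
have [q Xq] := @triangular_projection F g (enveloping g) (@env_inj F g) env_injL env_inj_lie
  (@presented_span F (Presentation (@env_rel_proper F g)))
  (nminus alpha) h (nplus alpha) (root_decomposition h_cartan alpha_pos)
  abel (@nplus_lie_cartan F g h N alpha) (hc_complement alpha)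
  (@HC_nminus F g h N alpha) (@HC_nplus F g h N alpha) (HC_zero alpha) (@HC_add F g h N alpha) z.
exact: (@classical_sets.xgetPex _ 0 (fun q => hc_complement alpha (z - Uh_inj q))
  (ex_intro _ q Xq)).
Qed.

End EnvelopingProjection.

(** * Polynomials and vector fields at the origin *)

Section InfinitesimalTransitivity.
Variables (F : numFieldType) (N : nat).
Local Notation poly := {mpoly F[N]}.

Lemma mcoeff0M (p q : poly) : (p * q)@_0%MM = p@_0%MM * q@_0%MM.
Proof. exact: (rmorphM (mcoeff 0%MM)). Qed.

Lemma mcoeff_deriv0 (p : poly) j : p^`M(j)@_0%MM = p@_U_(j)%MM.
Proof. by rewrite mcoeff_deriv add0m mnm0E. Qed.

Lemma mcoeffM_lowest (p q : poly) m : (forall k, (mdeg k < mdeg m)%N -> q@_k = 0) ->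
  (p * q)@_m = p@_0%MM * q@_m.
Proof.
move=> q0; elim/mpolyind: p => [|c k p _ _ IHp]; first by rewrite mul0r !mcoeff0 mul0r.
rewrite mulrDl !mcoeffD IHp mulrDl; congr (_ + _).
rewrite -scalerAl !mcoeffZ -mulrA; congr (_ * _); rewrite mcoeffX mulrC.
have [->|k0] := eqVneq k 0%MM; first by rewrite mpolyX0 mulr1 mul1r.
rewrite mul0r; have [km|km] := boolP (k <= m)%MM.
  rewrite -(submK km) addmC mcoeffMX q0 // -[in X in (_ < X)%N](submK km) mdegD.
  by rewrite -[X in (X < _)%N]addn0 ltn_add2l lt0n mdeg_eq0.
apply: memN_msupp_eq0; rewrite (perm_mem (msuppMX _ _)); apply: contra km.
by move=> /mapP[l _ ->]; apply: lem_addr.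
Qed.

(** At the origin the [i]-th vector field is the partial derivative in the direction
    [i]. If all members of [V] vanish to order [k] at the origin, then so do their
    images by the fields, whose lowest terms are the partial derivatives of those of
    degree [k.+1]; hence the members vanish to order [k.+1]. *)
Lemma invariant_vanishing (a : 'I_N -> 'I_N -> poly) (V : poly -> Prop) :
  (forall i j, (a i j)@_0%MM = (i == j)%:R) ->
  (forall p i, V p -> V (\sum_j a i j * p^`M(j))) ->
  (forall p, V p -> p@_0%MM = 0) -> forall p, V p -> p = 0.
Proof.
move=> a0 Va V0; suff Vk k p m : V p -> (mdeg m <= k)%N -> p@_m = 0.
  by move=> p Vp; apply/mpolyP => m; rewrite mcoeff0; apply: (Vk (mdeg m)).
elim: k p m => [|k IHk] p m Vp.
  by rewrite leqn0 mdeg_eq0 => /eqP ->; apply: V0.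
rewrite leq_eqVlt => /orP[/eqP mk|]; last by rewrite ltnS; apply: IHk.
have [i [k' mE]] : exists i k', m = (k' + U_(i))%MM.
  by apply: mnm_neq0; rewrite -mdeg_eq0 mk.
have dk' : mdeg k' = k by move: mk; rewrite mE mdegD mdeg1 addn1 => -[].
have := IHk _ k' (Va p i Vp); rewrite dk' leqnn => /(_ isT).
rewrite raddf_sum /= (bigD1 i) //= big1 => [|j ij]; rewrite mcoeffM_lowest.
- rewrite a0 eqxx mul1r addr0 mcoeff_deriv -mE => /eqP.
  by rewrite mulrn_eq0 /= => /eqP.
- move=> l; rewrite dk' => lk; rewrite mcoeff_deriv (IHk p) ?mul0rn //.
  by rewrite mdegD mdeg1 addn1.
- by rewrite a0 eq_sym (negbTE ij) mul0r.
- move=> l; rewrite dk' => lk; rewrite mcoeff_deriv (IHk p) ?mul0rn //.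
  by rewrite mdegD mdeg1 addn1.
Qed.

End InfinitesimalTransitivity.

(** * The action of g on polynomials *)

Section RealizedAction.
Variables (F : numFieldType) (g : lieAlgType F) (h : {vspace g}).
Hypothesis g_simple : simple_lie g.
Hypothesis h_cartan : cartan_subalgebra h.
Variables (N : nat) (alpha : 'I_N -> dual h) (f : N.-tuple g).
Hypothesis alpha_pos : positive_system alpha.
Hypothesis f_basis : root_basis alpha f.
Variable lambda : dual h.
Local Notation poly := {mpoly F[N]}.
Local Notation mu := (lambda + half_sum alpha).
Local Notation wt := (xweight alpha).
Local Notation ev b t := ((b : dual h) (vsproj h t) : F).

Definition pi_act (a : g) (p : poly) : poly :=
  \sum_j (pi_field alpha f a j * p)^`M(j) + pi_scalar alpha f mu a * p.

(** Transposing a vector field adds its divergence. Here the divergence vanishes: its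
    monomials would have the weight of [f_i], while weights of monomials are sums of
    positive roots. *)
Lemma pi_act_f (i : 'I_N) p : pi_act f`_i p = \sum_j pi_field alpha f f`_i j * p^`M(j).
Proof.
rewrite /pi_act (pi_scalar_nminus h_cartan alpha_pos f_basis) ?(f_nminus f_basis) //.
rewrite mul0r addr0; apply: eq_bigr => j _; rewrite mderivM.
suff -> : (pi_field alpha f f`_i j)^`M(j) = 0 by rewrite mul0r add0r.
apply/mpolyP => m; rewrite mcoeff0 mcoeff_deriv; apply/eqP.
apply: contraT; rewrite mulrn_eq0 /= => cN.
have := pi_field_weight h_cartan alpha_pos f_basis (f_weight f_basis i) cN.
rewrite xweightD xweightU => /addIr mi.
have : wt (m + U_(i))%MM = 0 by rewrite xweightD xweightU mi addNr.
move/(xweight_eq0 g_simple h_cartan alpha_pos)/eqP.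
by rewrite mnmD_eq0 mnm1_eq0 andbF.
Qed.

Lemma pi_act_origin a p : (forall j, (pi_field alpha f a j)@_0%MM = 0) ->
  (pi_act a p)@_0%MM =
  (\sum_j (pi_field alpha f a j)@_U_(j)%MM + (pi_scalar alpha f mu a)@_0%MM) * p@_0%MM.
Proof.
move=> a0; rewrite mcoeffD mcoeff0M mulrDl raddf_sum mulr_suml /=; congr (_ + _).
apply: eq_bigr => j _; rewrite mderivM mcoeffD !mcoeff0M a0 mul0r addr0.
by rewrite mcoeff_deriv0.
Qed.

Lemma pi_act_nplus_origin i z p : z \in root_space (alpha i) -> (pi_act z p)@_0%MM = 0.
Proof.
move=> zi; have zn : z \in nplus alpha by exact: (root_nplus zi).
rewrite pi_act_origin => [|j]; last first.
  by rewrite (pi_field0 g_simple) (proj_nminus_nplus h_cartan alpha_pos) ?linear0.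
rewrite (pi_scalar_nplus g_simple h_cartan f alpha_pos) // addr0 big1 ?mul0r // => j _.
apply/eqP; apply: contraT => cN.
have := pi_field_weight h_cartan alpha_pos f_basis zi cN.
rewrite xweightU => /eqP; rewrite -[X in X == _]add0r (inj_eq (addIr _)) eq_sym.
by rewrite (negbTE (root_neq0 alpha_pos i)).
Qed.

Lemma half_sumD : \sum_j alpha j = half_sum alpha + half_sum alpha.
Proof.
rewrite /half_sum -scalerDl -mulr2n -[_ *+ 2]mulr_natr mulVf ?scale1r //.
by rewrite pnatr_eq0.
Qed.

(** The divergence of the field of [t] contributes minus the sum of the positive
    roots, which turns [lambda + 2 rho] into [lambda]. *)
Lemma pi_act_cartan_origin t p : t \in h -> (pi_act t p)@_0%MM = ev lambda t * p@_0%MM.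
Proof.
move=> th; rewrite pi_act_origin => [|j]; last first.
  by rewrite (pi_field0 g_simple) (proj_nminus_cartan h_cartan alpha_pos) ?linear0.
congr (_ * _); rewrite (pi_scalar_cartan g_simple h_cartan alpha_pos f_basis) //.
rewrite mcoeffC eqxx mulr1.
have -> : \sum_j (pi_field alpha f t j)@_U_(j)%MM = - ev (\sum_j alpha j) t.
  rewrite sum_lfunE -sumrN; apply: eq_bigr => j _.
  by rewrite (pi_field_cartanU g_simple h_cartan alpha_pos f_basis) // eqxx.
by rewrite half_sumD !add_lfunE; ring.
Qed.

Hypothesis pi_actL : forall c a b p, pi_act (c *: a + b) p = c *: pi_act a p + pi_act b p.
Hypothesis pi_act_lie : forall a b p,
  pi_act b (pi_act a p) - pi_act a (pi_act b p) = pi_act (lie a b) p.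

Lemma pi_act_zero p : pi_act 0 p = 0.
Proof. by have := pi_actL (-1) 0 0 p; rewrite scaler0 addr0 scaleN1r addNr. Qed.

Lemma pi_actD a b p : pi_act (a + b) p = pi_act a p + pi_act b p.
Proof. by have := pi_actL 1 a b p; rewrite !scale1r. Qed.

Lemma pi_actZ c a p : pi_act (c *: a) p = c *: pi_act a p.
Proof. by rewrite -[c *: a]addr0 pi_actL pi_act_zero addr0. Qed.

Lemma pi_actDr a p q : pi_act a (p + q) = pi_act a p + pi_act a q.
Proof.
rewrite /pi_act mulrDr addrACA -big_split; congr (_ + _).
by apply: eq_bigr => j _; rewrite mulrDr mderivD.
Qed.

Lemma pi_actZr a c p : pi_act a (c *: p) = c *: pi_act a p.
Proof.
rewrite /pi_act scalerDr scaler_sumr -scalerAr; congr (_ + _).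
by apply: eq_bigr => j _; rewrite -scalerAr mderivZ.
Qed.

(** The operator for which x^m is an eigenvector of eigenvalue the value at [t] of
    [lambda - wt m]. *)
Definition euler t (p : poly) : poly :=
  ev lambda t *: p - \sum_j ev (alpha j) t *: ('X_j * p^`M(j)).

Lemma eulerE t p m : (euler t p)@_m = ev (lambda - wt m) t * p@_m.
Proof.
rewrite mcoeffB mcoeffZ add_lfunE opp_lfunE mulrBl; congr (_ - _).
rewrite raddf_sum sum_lfunE mulr_suml; apply: eq_bigr => j _ /=.
have -> : ev (alpha j *+ m j) t = (m j)%:R * ev (alpha j) t.
  by rewrite -scaler_nat scale_lfunE.
rewrite mcoeffZ mcoeffXM mcoeff_deriv.
case: eqP => [->|/eqP mj]; first by rewrite mulr0 !mul0r.
have Um : (U_(j) <= m)%MM by rewrite lep1mP.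
rewrite (submK Um) mnmBE mnm1E eqxx subn1 prednK ?lt0n //.
by rewrite -[p@_m *+ _]mulr_natl mulrA [_ * (m j)%:R]mulrC.
Qed.

Lemma euler_f t (i : 'I_N) p : pi_act f`_i (euler t p) - euler t (pi_act f`_i p) =
  - ev (alpha i) t *: pi_act f`_i p.
Proof.
apply/mpolyP => m; rewrite mcoeffB mcoeffZ eulerE.
suff -> : (pi_act f`_i (euler t p))@_m = ev (lambda - wt m - alpha i) t * (pi_act f`_i p)@_m.
  by rewrite [in X in X * _ - _]add_lfunE opp_lfunE -mulrBl addrC addrA addNr add0r.
rewrite !pi_act_f !(raddf_sum (mcoeff m)) mulr_sumr; apply: eq_bigr => j _ /=.
rewrite !mcoeffM mulr_sumr; apply: eq_bigr => -[k l] /= /eqP mkl.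
have [->|cN] := eqVneq (pi_field alpha f f`_i j)@_k 0; first by rewrite !mul0r mulr0.
have := pi_field_weight h_cartan alpha_pos f_basis (f_weight f_basis i) cN.
rewrite mulrCA; move=> kE; congr (_ * _).
rewrite !mcoeff_deriv eulerE mulrnAr; congr (_ * _ *+ _).
have := congr1 wt mkl; rewrite xweightD kE => ->.
by rewrite xweightD xweightU !(add_lfunE, opp_lfunE); ring.
Qed.

(** The action of [t] and [euler t] have the same commutators with the fields of the
    [f_i], the first because the realization is a morphism, the second by the weights
    of the coefficients of the fields. So the image of their difference is preserved
    by these fields, and it vanishes at the origin. *)
Lemma pi_act_cartan t p m : t \in h ->
  (pi_act t p)@_m = ev (lambda - wt m) t * p@_m.
Proof.
move=> th; rewrite -eulerE; congr (_@_ _); apply/eqP; rewrite -subr_eq0; apply/eqP.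
pose V q := exists q', q = pi_act t q' - euler t q'.
apply: (@invariant_vanishing _ _ (fun i j => pi_field alpha f f`_i j) V); last by exists p.
- by move=> i j; rewrite (pi_field_f0 g_simple h_cartan alpha_pos f_basis).
- move=> _ i [q ->]; exists (pi_act f`_i q); rewrite -pi_act_f.
  have -> : pi_act f`_i (pi_act t q - euler t q) =
      pi_act f`_i (pi_act t q) - pi_act f`_i (euler t q).
    by rewrite pi_actDr -scaleN1r pi_actZr scaleN1r.
  have E1 := pi_act_lie t f`_i q; have E2 := euler_f t i q.
  rewrite lie_anti (f_lie_cartan f_basis) // -scaleNr pi_actZ -E2 in E1.
  move: E1; set u := pi_act f`_i (pi_act t q); set v := pi_act t (pi_act f`_i q).
  set u' := pi_act f`_i (euler t q); set v' := euler t (pi_act f`_i q) => E1.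
  have -> : u = u' - v' + v by rewrite -E1 subrK.
  by rewrite addrAC [u' - v']addrC addrK addrC.
- move=> _ [q ->]; rewrite mcoeffB pi_act_cartan_origin // eulerE.
  by rewrite xweight0 subr0 subrr.
Qed.

(** [T] preserves weights, since it commutes with [h], and among the monomials only 1
    has weight [lambda]; so the value at the origin of [T p] is a constant multiple
    of that of [p]. The image of the difference of [T] and this constant then
    vanishes at the origin and is preserved by the fields of the [f_i]. *)
Lemma commuting_scalar (T : poly -> poly) :
  (forall p q, T (p + q) = T p + T q) -> (forall c p, T (c *: p) = c *: T p) ->
  (forall a p, T (pi_act a p) = pi_act a (T p)) ->
  forall p, T p = (T 1)@_0%MM *: p.
Proof.
move=> TD TZ Tpi p; set c := (T 1)@_0%MM.
have T0 q : (T q)@_0%MM = c * q@_0%MM.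
  elim/mpolyind: q => [|b m q _ _ IHq].
    by rewrite -[0 in LHS](scale0r 1) TZ scale0r !mcoeff0 mulr0.
  rewrite TD TZ !mcoeffD IHq mulrDr !mcoeffZ mcoeffX; congr (_ + _).
  rewrite mulrCA; congr (_ * _); have [->|m0] := eqVneq m 0%MM; first by rewrite mpolyX0 mulr1.
  rewrite mulr0; apply/eqP; apply: contraT => Tm.
  have : wt m <> 0 by move/(xweight_eq0 g_simple h_cartan alpha_pos); apply/eqP.
  case; apply/lfunP => t; rewrite zero_lfunE -[t]vsvalK; set s := vsval t.
  have sh : s \in h by apply: subvsP.
  have := congr1 (mcoeff 0%MM) (Tpi s 'X_[m]).
  have -> : pi_act s 'X_[m] = ev (lambda - wt m) s *: 'X_[m].
    apply/mpolyP => k; rewrite pi_act_cartan // mcoeffZ mcoeffX.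
    by case: eqP => [->|]; rewrite ?mulr0.
  rewrite TZ mcoeffZ pi_act_cartan // xweight0 subr0 => /(mulIf Tm).
  rewrite add_lfunE opp_lfunE => /eqP.
  by rewrite -[X in _ == X]addr0 (inj_eq (addrI _)) oppr_eq0 => /eqP.
apply/eqP; rewrite -subr_eq0; apply/eqP.
pose V q := exists q', q = T q' - c *: q'.
apply: (@invariant_vanishing _ _ (fun i j => pi_field alpha f f`_i j) V); last by exists p.
- by move=> i j; rewrite (pi_field_f0 g_simple h_cartan alpha_pos f_basis).
- move=> _ i [q ->]; exists (pi_act f`_i q); rewrite -pi_act_f.
  by rewrite pi_actDr -scaleN1r !pi_actZr Tpi scaleN1r.
- by move=> _ [q ->]; rewrite mcoeffB mcoeffZ T0 subrr.
Qed.

End RealizedAction.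

(** * Central elements *)

Section Eigenvector.
Variables (F : fieldType) (n : nat) (V : lmodType F) (chi : {mpoly F[n]} -> V).
Variables (mu : 'I_n -> F) (v : V).
Hypothesis chiD : forall p q, chi (p + q) = chi p + chi q.
Hypothesis chiZ : forall c p, chi (c *: p) = c *: chi p.
Hypothesis chiMX : forall p j, chi p = p.@[mu] *: v -> chi (p * 'X_j) = (p.@[mu] * mu j) *: v.
Hypothesis chi1 : chi 1 = v.

Lemma eigenvector_meval p : chi p = p.@[mu] *: v.
Proof.
elim/mpolyind: p => [|c m p _ _ IHp].
  by rewrite meval0 scale0r -[0 in LHS](scale0r 0) chiZ scale0r.
rewrite chiD IHp mevalD scalerDl; congr (_ + _).
rewrite chiZ mevalZ -scalerA; congr (_ *: _).
elim/mnm_ind: m => [|m j IHm]; first by rewrite mpolyX0 chi1 meval1 scale1r.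
by rewrite mpolyXD chiMX // mevalM mevalXU.
Qed.

End Eigenvector.

Section CentralElements.
Variables (F : numFieldType) (g : lieAlgType F) (h : {vspace g}).
Hypothesis g_simple : simple_lie g.
Hypothesis h_cartan : cartan_subalgebra h.
Variables (N : nat) (alpha : 'I_N -> dual h) (f : N.-tuple g).
Hypothesis alpha_pos : positive_system alpha.
Hypothesis f_basis : root_basis alpha f.
Variable lambda : dual h.
Variable Pi : {lrmorphism enveloping g -> weyl F N}.
Hypothesis Pi_ext : forall a : g, Pi (env_inj a) = pi_op alpha f (lambda + half_sum alpha) a.
Local Notation hbasis i := ((vbasis h)`_(nat_of_ord i)).
Local Notation act := (pi_act alpha f lambda).

Lemma ract_pi_op p a :
  ract p (pi_op alpha f (lambda + half_sum alpha) a) = act a p.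
Proof.
apply: etrans (ractD _ _ _) _; apply: congr2; last exact: ract_poly.
apply: etrans (ractN _ _) _; rewrite ract_sum -sumrN; apply: eq_bigr => j _.
apply: etrans (congr1 -%R (ractM _ _ _)) _.
by rewrite ract_poly ract_d opprK.
Qed.

Lemma ract_Pi p a : ract p (Pi (env_inj a)) = act a p.
Proof. by rewrite Pi_ext ract_pi_op. Qed.

Lemma ract_PiM p u v : ract p (Pi (u * v)) = ract (ract p (Pi u)) (Pi v).
Proof. by rewrite rmorphM; apply: ractM. Qed.

Lemma ract_PiD p u v : ract p (Pi (u + v)) = ract p (Pi u) + ract p (Pi v).
Proof. by rewrite raddfD; apply: ractD. Qed.

Lemma ract_PiB p u v : ract p (Pi (u - v)) = ract p (Pi u) - ract p (Pi v).
Proof. by rewrite raddfB; apply: etrans (ractD _ _ _) _; rewrite ractN. Qed.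

Lemma ract_PiZ p c u : ract p (Pi (c *: u)) = c *: ract p (Pi u).
Proof. by rewrite linearZ; apply: ractZ. Qed.

Lemma act_linear c a b p : act (c *: a + b) p = c *: act a p + act b p.
Proof. by rewrite -!ract_Pi env_injL ract_PiD ract_PiZ. Qed.

Lemma act_lie a b p : act b (act a p) - act a (act b p) = act (lie a b) p.
Proof.
rewrite -!ract_Pi -env_inj_lie; apply: esym; apply: etrans (ract_PiB _ _ _) _.
exact: (congr2 (fun u v => u - v) (ract_PiM _ _ _) (ract_PiM _ _ _)).
Qed.

Lemma act0_l p : act 0 p = 0.
Proof. exact: pi_act_zero act_linear p. Qed.

Lemma act_cartan1 t : t \in h -> act t 1 = (lambda (vsproj h t) : F) *: 1.
Proof.
move=> th; apply/mpolyP => m.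
rewrite (pi_act_cartan g_simple h_cartan alpha_pos f_basis act_linear act_lie) //.
rewrite mcoeffZ mcoeff1; have [->|_] := eqVneq m 0%MM; last by rewrite !mulr0.
by rewrite xweight0 subr0.
Qed.

Lemma act_nminus1 y : y \in nminus alpha -> act y 1 = 0.
Proof.
rewrite -(span_basis f_basis.1) => /coord_span ->.
elim/big_rec: _ => [|i s _ s0]; first exact: act0_l.
rewrite act_linear s0 addr0 (pi_act_f g_simple h_cartan alpha_pos f_basis).
by rewrite big1 ?scaler0 // => j _; rewrite -[1]mpolyC1 mderivC mulr0.
Qed.

Lemma act_nplus_origin x p : x \in nplus alpha -> (act x p)@_0%MM = 0.
Proof.
move=> /memv_sumP[u uw ->]; elim/big_rec: _ => [|i s _ s0].
  by rewrite act0_l mcoeff0.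
rewrite (pi_actD act_linear (u i) s p) mcoeffD.
have u0 := pi_act_nplus_origin g_simple h_cartan alpha_pos f_basis lambda p (uw i isT).
by apply: etrans (congr2 +%R u0 s0) _; rewrite addr0.
Qed.

(** The polynomial 1 plays the role of a vector of weight [lambda] killed by nminus,
    and evaluation at the origin that of a functional killed by nplus. *)
Definition vacuum (u : enveloping g) : F := (ract 1 (Pi u))@_0%MM.

Lemma vacuum_complement u : hc_complement alpha u -> vacuum u = 0.
Proof.
elim=> {u} [y u yn|u x xn||u v _ u0 _ v0].
- by rewrite /vacuum ract_PiM ract_Pi act_nminus1 // ract0l mcoeff0.
- by rewrite /vacuum ract_PiM ract_Pi act_nplus_origin.
- by rewrite /vacuum raddf0 ract0 mcoeff0.
- by rewrite /vacuum ract_PiD mcoeffD -/(vacuum u) -/(vacuum v) u0 v0 addr0.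
Qed.

Lemma ract_Uh (q : {mpoly F[\dim h]}) : ract 1 (Pi (Uh_inj q)) = (Uh_eval lambda q) *: 1.
Proof.
have [abel _ _] := h_cartan.
have hh := iota_hh (@env_injL F g) (@env_inj_lie F g) abel.
apply: (@eigenvector_meval _ _ _ (fun q => ract 1 (Pi (Uh_inj q)))) => [r s|c r|r j|].
- exact: etrans (congr1 (fun u => ract 1 (Pi u)) (mmapD _ _ _ _)) (ract_PiD _ _ _).
- exact: etrans (congr1 (fun u => ract 1 (Pi u)) (in_alg_mmapZ _ _ _)) (ract_PiZ _ _ _).
- move=> rE; apply: etrans (congr1 (fun u => ract 1 (Pi u)) (mmap_commMX hh _ _)) _.
  apply: etrans (ract_PiM _ _ _) _; apply: etrans (congr1 (fun p => ract p _) rE) _.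
  apply: etrans (ractZl _ _ _) _; apply: etrans (congr1 _ (ract_Pi _ _)) _.
  apply: etrans (congr1 _ (act_cartan1 (hbasis_h j))) _.
  by rewrite scalerA.
- have -> : Uh_inj (1 : {mpoly F[\dim h]}) = 1 :> enveloping g.
    by rewrite /Uh_inj -[X in mmap _ _ X]mpolyX0 mmapX mmap11.
  by rewrite rmorph1 ract1.
Qed.

(** The shift by rho in the Harish-Chandra morphism and the one in the infinitesimal
    character cancel. *)
Lemma central_char_shift (z : enveloping g) :
  central_char alpha (lambda + half_sum alpha) z = Uh_eval lambda (hc_proj alpha z).
Proof.
rewrite /central_char /harish_chandra /hc_shift /Uh_eval comp_mpoly_meval.
apply: meval_eq => i; rewrite tnth_mktuple mevalB mevalXU mevalC add_lfunE.
by rewrite addrK.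
Qed.

Lemma vacuum_central_char (z : enveloping g) :
  vacuum z = central_char alpha (lambda + half_sum alpha) z.
Proof.
rewrite central_char_shift; have Cz := hc_projP h_cartan alpha_pos z.
rewrite -[z in LHS](subrK (Uh_inj (hc_proj alpha z))) /vacuum ract_PiD mcoeffD.
rewrite -/(vacuum _) vacuum_complement // add0r ract_Uh mcoeffZ mcoeff1 eqxx.
by rewrite mulr1.
Qed.

Lemma central_scalar (z : enveloping g) : env_central z ->
  Pi z = (central_char alpha (lambda + half_sum alpha) z)%:A.
Proof.
move=> zC; apply/eqP; rewrite -subr_eq0; apply/eqP; apply: ract_faithful => [n|p].
  by rewrite pnatr_eq0.
apply: etrans (ractD _ _ _) _; apply: etrans (congr1 _ (ractN _ _)) _.
rewrite ractZ ract1 -vacuum_central_char.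
have := @commuting_scalar _ _ _ g_simple h_cartan _ _ _ alpha_pos f_basis lambda
  act_linear act_lie (fun p => ract p (Pi z)).
move=> -> //; first by rewrite subrr.
- by move=> q r; apply: ractDl.
- by move=> c q; apply: ractZl.
- by move=> a q; rewrite -!ract_Pi -!ract_PiM zC.
Qed.

End CentralElements.

Theorem theorem2p6 (R : realType) (g : lieAlgType R[i])
    (g_simple : simple_lie g) (g_not_sl2 : ~ isomorphic_to_sl2 g)
    (h : {vspace g}) (h_cartan : cartan_subalgebra h)
    (N : nat) (alpha : 'I_N -> dual h) (alpha_pos : positive_system alpha)
    (theta : 'I_N) (theta_max : maximal_root alpha theta)
    (f : N.-tuple g) (f_basis : root_basis alpha f)
    (lambda : dual h)
    (Pi : {lrmorphism enveloping g -> weyl R[i] N})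
    (Pi_ext : forall a : g,
       Pi (env_inj a) = pi_op alpha f (lambda + half_sum alpha) a)
    (z : enveloping g) (z_central : env_central z)
    (v : gt_module R[i] theta) :
  Pi z *: v = (central_char alpha (lambda + half_sum alpha) z)%:A *: v.
Proof.
by rewrite (central_scalar g_simple h_cartan alpha_pos f_basis Pi_ext z_central).
Qed.
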